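(* Let $A{_\tau\times_\sigma}B$ be a smash biproduct bialgebra such that $\sigma$ is left conormal and right conormal. Then $A{_\tau\times_\sigma}B$ admits a quasitriangular structure if and only if there exist normalized elements $W=\sum W^1\otimes W^2\in B\otimes B$, $X=\sum X^1\otimes X^2\in A\otimes B$, $Y=\sum Y^1\otimes Y^2\in B\otimes A$ and $Z=\sum Z^1\otimes Z^2\in A\otimes A$ satisfying the following identities C1''')–C19''') for all $a\in A$, $b\in B$: C1''') $\sum Z^1a_{(1)}\otimes Z^2a_{(2)}=\sum a_{(2)}Z^1\otimes a_{(1)}Z^2$; C2''') $\sum X^1a\otimes X^2=\sum a_\tau X^1\otimes 1_{B\tau}X^2$; C3''') $\sum Y^11_{B\tau}\otimes Y^2a_\tau=\sum Y^1\otimes aY^2$; C4''') $\sum Z^1\otimes Z^2\epsilon_B(b)=\sum Z^1\otimes Z^2\epsilon_B(b)$ (a trivial identity); C5''') $\sum X^1\otimes X^2b=\sum 1_{A\tau}X^1\otimes b_\tau X^2$; C6''') $\sum Y^1b_\tau\otimes Y^21_{A\tau}=\sum bY^1\otimes Y^2$; C7''') $\sum W^1b_{(1)}\otimes W^2b_{(2)}=\sum b_{(2)}W^1\otimes b_{(1)}W^2$; C8''') $\sum Z^1_{(1)}\otimes Z^1_{(2)}\otimes Z^2=\sum Z^1\otimes\bar Z^1\otimes Z^2\bar Z^2$; C9''') $\sum X^1_{(1)}\otimes X^1_{(2)}\otimes X^2=\sum X^1\otimes\bar X^1\otimes X^2\bar X^2$; C10''') $\sum Y^1_\tau\otimes Z^1_\tau\otimes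 Z^2Y^2=\sum Y^1\otimes Z^1\otimes Y^2Z^2$; C11''') $\sum W^1_\tau\otimes X^1_\tau\otimes X^2W^2=\sum W^1\otimes X^1\otimes W^2X^2$; C12''') $\sum Y^1_{(1)}\otimes Y^1_{(2)}\otimes Y^2=\sum Y^1\otimes\bar Y^1\otimes Y^2\bar Y^2$; C13''') $\sum W^1_{(1)}\otimes W^1_{(2)}\otimes W^2=\sum W^1\otimes\bar W^1\otimes W^2\bar W^2$; C14''') $\sum Z^1\otimes Z^2_{(1)}\otimes Z^2_{(2)}=\sum Z^1\bar Z^1\otimes\bar Z^2\otimes Z^2$; C15''') $\sum Z^1_{\tau_1}X^1\otimes(1_{B\tau_1}X^2)_{\tau_2}\otimes Z^2_{\tau_2}=\sum Z^1X^1\otimes X^2\otimes Z^2$; C16''') $\sum X^1\otimes X^2_{(1)}\otimes X^2_{(2)}=\sum X^1\bar X^1\otimes\bar X^2\otimes X^2$; C17''') $\sum Y^1\otimes Y^2_{(1)}\otimes Y^2_{(2)}=\sum Y^1\bar Y^1\otimes\bar Y^2\otimes Y^2$; C18''') $\sum W^1Y^1\otimes W^2_\tau\otimes Y^2_\tau=\sum Y^1W^1\otimes W^2\otimes Y^2$; C19''') $\sum W^1\otimes W^2_{(1)}\otimes W^2_{(2)}=\sum W^1\bar W^1\otimes\bar W^2\otimes W^2$. In this case, the quasitriangular structure is given as $$\alpha=\sum Z^1_\tau X^1\otimes W^1Y^1\otimes Z^2Y^2\otimes 1_{B\tau}X^2W^2\in(A\otimes B)\otimes(A\otimes B).$$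
   Context: Everything is over a field $\Bbbk$. Algebras are associative and unital, coalgebras coassociative and counital; $\Delta(c)=\sum c_{(1)}\otimes c_{(2)}$. Smash product: for algebras $A,B$ and a linear map $\sigma:B\otimes A\to A\otimes B$, written $\sigma(b\otimes a)=\sum a_\sigma\otimes b_\sigma$, consider on $A\otimes B$ the multiplication $(a\otimes b)(a'\otimes b')=\sum aa'_\sigma\otimes b_\sigma b'$. If it is associative with unit $1_A\otimes 1_B$, this algebra is the smash product $A\#_\sigma B$. Smash coproduct: for coalgebras $A,B$ and a linear map $\tau:A\otimes B\to B\otimes A$, written $\tau(a\otimes b)=\sum b_\tau\otimes a_\tau$, consider on $A\otimes B$ the comultiplication $a\otimes b\mapsto\sum a_{(1)}\otimes b_{(1)\tau}\otimes a_{(2)\tau}\otimes b_{(2)}$. If it is coassociative with counit $\epsilon_A\otimes\epsilon_B$, this coalgebra is the smash coproduct $A{_\tau\ltimes}B$. Smash biproduct: if $A,B$ are both algebras and coalgebras (neither necessarily a bialgebra), $A\#_\sigma B$ is a smash product, $A{_\tau\ltimes}B$ is a smash coproduct, and $A\otimes B$ with these two structures is a bialgebra, this bialgebra is denoted $A{_\tau\times_\sigma}B$ and called a smash biproduct bialgebra. Standing assumption: for every smash biproduct bialgebra, $A$ and $B$ are counital algebras via $\epsilon_A,\epsilon_B$ (i.e. $\epsilon_A,\epsilon_B$ are algebra maps to $\Bbbk$) and unital coalgebras via $\eta_A,\eta_B$ (i.e. the unit maps $\Bbbk\to A$, $\Bbbk\to B$ are coalgebra maps). $\sigma$ is right conormal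 if $\sum\epsilon_A(a_\sigma)b_\sigma=\epsilon_A(a)b$ for all $a\in A,b\in B$; $\sigma$ is left conormal if $\sum a_\sigma\epsilon_B(b_\sigma)=a\,\epsilon_B(b)$ for all $a\in A,b\in B$. A quasitriangular structure of a bialgebra $H$ is an element $\mathcal R=\sum\mathcal R^1\otimes\mathcal R^2\in H\otimes H$ (not required invertible) with: (QT1) $(\epsilon_H\otimes id)(\mathcal R)=1_H=(id\otimes\epsilon_H)(\mathcal R)$; (QT2) $(\Delta_H\otimes id)(\mathcal R)=\mathcal R_{13}\mathcal R_{23}$; (QT3) $(id\otimes\Delta_H)(\mathcal R)=\mathcal R_{13}\mathcal R_{12}$; (QT4) $\mathcal R\Delta_H(h)=\Delta_H^{cop}(h)\mathcal R$ for all $h\in H$. For $H=A{_\tau\times_\sigma}B$, $H\otimes H=A\otimes B\otimes A\otimes B$. Normalized elements: $W\in B\otimes B$ is normalized if $\sum\epsilon_B(W^1)W^2=1_B=\sum W^1\epsilon_B(W^2)$; $X\in A\otimes B$ if $\sum\epsilon_A(X^1)X^2=1_B$ and $\sum X^1\epsilon_B(X^2)=1_A$; $Y\in B\otimes A$ if $\sum\epsilon_B(Y^1)Y^2=1_A$ and $\sum Y^1\epsilon_A(Y^2)=1_B$; $Z\in A\otimes A$ if $\sum\epsilon_A(Z^1)Z^2=1_A=\sum Z^1\epsilon_A(Z^2)$. Index notation: $\tau_i$ is a copy of $\tau$. If an index $\tau_i$ appears on an element coming from $A$ and on an element coming from $B$, then $\tau_i$ has been applied to ($A$-element)$\otimes$($B$-element).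 Several subscripts on one element are applied successively from left to right; an index on a bracketed product applies to the product. Decorated letters such as $\bar X=\sum\bar X^1\otimes\bar X^2$ denote further copies of the same element $X$ (likewise for $W,Y,Z$). For example, in $\alpha$, $\tau$ is applied to $Z^1\otimes 1_B$; in C15'''), $\tau_1$ is applied to $Z^1\otimes 1_B$ and then $\tau_2$ to $Z^2\otimes 1_{B\tau_1}X^2$. *)

(* Defs.v *)
From HB Require Import structures.
From mathcomp Require Import all_boot all_order all_algebra generic_quotient.
From mathcomp Require Import boolp.

Set Implicit Arguments.
Unset Strict Implicit.
Unset Printing Implicit Defensive.

Import GRing.Theory.

Local Open Scope ring_scope.
Local Open Scope quotient_scope.

Set Warnings "-redundant-canonical-projection".


Reserved Notation "V ⊗ W" (at level 38, right associativity).
Reserved Notation "\tsum_ ( x , y <- t ) F"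
  (at level 41, F at level 41, x, y, t at level 50,
   format "\tsum_ ( x ,  y  <-  t )  F").

(* Tensor products of vector spaces of arbitrary dimension.  An element is a
   finite formal sum of pairs, two formal sums being identified when every
   bilinear map takes the same value on them. *)

Section TensorProduct.
Variables (k : fieldType) (V W : lmodType k).

Definition tensor_equiv_def (s t : seq (V * W)) : bool :=
  `[< forall (U : lmodType k) (f : {bilinear V -> W -> U}),
        \sum_(p <- s) f p.1 p.2 = \sum_(p <- t) f p.1 p.2 >].

Lemma tensor_equiv_refl : reflexive tensor_equiv_def.
Proof. by move=> s; apply/asboolP. Qed.

Lemma tensor_equiv_sym : symmetric tensor_equiv_def.
Proof.
by move=> s t; apply/idP/idP => /asboolP h; apply/asboolP => U f; rewrite h.
Qed.

Lemma tensor_equiv_trans : transitive tensor_equiv_def.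
Proof.
move=> t s u /asboolP st /asboolP tu; apply/asboolP => U f.
by rewrite st tu.
Qed.

Canonical tensor_equiv :=
  EquivRel tensor_equiv_def tensor_equiv_refl tensor_equiv_sym
    tensor_equiv_trans.

Definition tensor : Type := {eq_quot tensor_equiv}.

HB.instance Definition _ := Choice.on tensor.
HB.instance Definition _ := EqQuotient.on tensor.

Implicit Types (s : seq (V * W)) (t u : tensor).

Lemma tensor_piP s s' :
  reflect (forall (U : lmodType k) (f : {bilinear V -> W -> U}),
             \sum_(p <- s) f p.1 p.2 = \sum_(p <- s') f p.1 p.2)
          (\pi_tensor s == \pi_tensor s').
Proof. by rewrite piE; apply: asboolP. Qed.

Lemma repr_piE s (U : lmodType k) (f : {bilinear V -> W -> U}) :
  \sum_(p <- repr (\pi_tensor s)) f p.1 p.2 = \sum_(p <- s) f p.1 p.2.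
Proof. by move: U f; apply/tensor_piP; rewrite reprK. Qed.

Definition tensor_zero : tensor := \pi_tensor [::].
Definition tensor_add t u : tensor := \pi_tensor (repr t ++ repr u).
Definition tensor_scale (c : k) t : tensor :=
  \pi_tensor [seq (c *: p.1, p.2) | p <- repr t].
Definition tensor_opp t : tensor := tensor_scale (-1) t.

Lemma tensorP t u :
  (forall (U : lmodType k) (f : {bilinear V -> W -> U}),
     \sum_(p <- repr t) f p.1 p.2 = \sum_(p <- repr u) f p.1 p.2) -> t = u.
Proof. by move=> h; rewrite -[t]reprK -[u]reprK; apply/eqP/tensor_piP. Qed.

Lemma repr_zeroE (U : lmodType k) (f : {bilinear V -> W -> U}) :
  \sum_(p <- repr tensor_zero) f p.1 p.2 = 0.
Proof. by rewrite repr_piE big_nil. Qed.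

Lemma repr_addE t u (U : lmodType k) (f : {bilinear V -> W -> U}) :
  \sum_(p <- repr (tensor_add t u)) f p.1 p.2 =
  \sum_(p <- repr t) f p.1 p.2 + \sum_(p <- repr u) f p.1 p.2.
Proof. by rewrite repr_piE big_cat. Qed.

Lemma repr_scaleE c t (U : lmodType k) (f : {bilinear V -> W -> U}) :
  \sum_(p <- repr (tensor_scale c t)) f p.1 p.2 =
  c *: \sum_(p <- repr t) f p.1 p.2.
Proof.
rewrite repr_piE big_map scaler_sumr; apply: eq_bigr => p _ /=.
by rewrite linearZl_LR.
Qed.

Lemma tensor_addA : associative tensor_add.
Proof. by move=> t u v; apply: tensorP => U f; rewrite !repr_addE addrA. Qed.

Lemma tensor_addC : commutative tensor_add.
Proof. by move=> t u; apply: tensorP => U f; rewrite !repr_addE addrC. Qed.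

Lemma tensor_add0 : left_id tensor_zero tensor_add.
Proof.
by move=> t; apply: tensorP => U f; rewrite repr_addE repr_zeroE add0r.
Qed.

Lemma tensor_addN : left_inverse tensor_zero tensor_opp tensor_add.
Proof.
move=> t; apply: tensorP => U f.
by rewrite repr_addE repr_scaleE repr_zeroE scaleN1r addNr.
Qed.

HB.instance Definition _ :=
  GRing.isZmodule.Build tensor tensor_addA tensor_addC tensor_add0 tensor_addN.

Lemma tensor_scaleA (a b : k) t :
  tensor_scale a (tensor_scale b t) = tensor_scale (a * b) t.
Proof. by apply: tensorP => U f; rewrite !repr_scaleE scalerA. Qed.

Lemma tensor_scale1 : left_id 1 tensor_scale.
Proof. by move=> t; apply: tensorP => U f; rewrite repr_scaleE scale1r. Qed.

Lemma tensor_scaleDr : right_distributive tensor_scale +%R.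
Proof.
move=> c t u; apply: tensorP => U f.
by rewrite repr_scaleE !repr_addE !repr_scaleE scalerDr.
Qed.

Lemma tensor_scaleDl t :
  {morph tensor_scale^~ t : a b / a + b}.
Proof.
move=> a b; apply: tensorP => U f.
by rewrite repr_addE !repr_scaleE scalerDl.
Qed.

HB.instance Definition _ :=
  GRing.Zmodule_isLmodule.Build k tensor
    tensor_scaleA tensor_scale1 tensor_scaleDr tensor_scaleDl.

Definition tens (v : V) (w : W) : tensor := \pi_tensor [:: (v, w)].

(* Sweedler-style summation: for t = sum_i v_i ⊗ w_i, the value of
   sum_i F v_i w_i, computed on a chosen decomposition of t.  When F is
   bilinear it does not depend on that decomposition (tsumE below); it is only
   ever used for such F. *)
Definition tsum (U : lmodType k) (F : V -> W -> U) (t : tensor) : U :=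
  \sum_(p <- repr t) F p.1 p.2.

End TensorProduct.

Arguments tensor {k} (V W)%_type_scope.

Notation "V ⊗ W" := (tensor V W) : type_scope.
Notation "v ⊗ w" := (tens v w) : ring_scope.
Notation "\tsum_ ( x , y <- t ) F" := (tsum (fun x y => F) t) : ring_scope.

Section TensorFacts.
Variables (k : fieldType) (V W : lmodType k).

Lemma tsum_is_linear (U : lmodType k) (F : V -> W -> U) :
  bilinear_for *:%R *:%R F -> linear (tsum F).
Proof.
move=> bF; pose bA := bilinear_isBilinear.Build _ _ _ _ _ _ F bF.
pose f : {bilinear V -> W -> U} := HB.pack F bA.
move=> c t u; rewrite /tsum.
by rewrite (repr_addE _ _ f) (repr_scaleE _ _ f).
Qed.

Lemma tsum_tens (U : lmodType k) (F : V -> W -> U) :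
  bilinear_for *:%R *:%R F -> forall v w, tsum F (v ⊗ w) = F v w.
Proof.
move=> bF v w; pose bA := bilinear_isBilinear.Build _ _ _ _ _ _ F bF.
pose f : {bilinear V -> W -> U} := HB.pack F bA.
by rewrite /tsum (repr_piE _ f) big_seq1.
Qed.

Lemma tens_is_bilinear : bilinear_for *:%R *:%R (@tens k V W).
Proof.
split=> [w|v] c x y; apply: tensorP => U f.
  rewrite repr_addE repr_scaleE !repr_piE !big_seq1 /=.
  by rewrite linearDl linearZl_LR.
rewrite repr_addE repr_scaleE !repr_piE !big_seq1 /=.
by rewrite linearDr linearZr_LR.
Qed.

HB.instance Definition _ :=
  bilinear_isBilinear.Build k V W (V ⊗ W)%type *:%R *:%R (@tens k V W)
    tens_is_bilinear.

Lemma tensE (t : V ⊗ W) : t = \tsum_(v, w <- t) v ⊗ w.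
Proof.
apply: tensorP => U f.
pose g (t : V ⊗ W) := \sum_(p <- repr t) f p.1 p.2.
have g0 : g 0 = 0 by apply: repr_zeroE.
have gD : {morph g : x y / x + y} by move=> x y; apply: repr_addE.
rewrite -!/(g _) /tsum (big_morph g gD g0).
by apply: eq_bigr => p _; rewrite /g repr_piE big_seq1.
Qed.

Lemma tsumE (U : lmodType k) (F : V -> W -> U) (s : seq (V * W)) :
  bilinear_for *:%R *:%R F ->
  tsum F (\sum_(p <- s) p.1 ⊗ p.2) = \sum_(p <- s) F p.1 p.2.
Proof.
move=> bF; have lF := tsum_is_linear bF.
have F0 : tsum F 0 = 0.
  by have := lF (-1) 0 0; rewrite scaler0 addr0 scaleN1r addNr.
have FD : {morph tsum F : x y / x + y}.
  by move=> x y; have := lF 1 x y; rewrite !scale1r.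
rewrite (big_morph _ FD F0); apply: eq_bigr => p _.
exact: tsum_tens.
Qed.

End TensorFacts.

Section TsumParametric.
Variables (k : fieldType) (T V W U : lmodType k).

Lemma linear_tsum (F : T -> V -> W -> U) (t : V ⊗ W) :
  (forall v w, linear (fun x => F x v w)) ->
  linear (fun x => \tsum_(v, w <- t) F x v w).
Proof.
move=> lF c x y; rewrite /tsum scaler_sumr -big_split.
by apply: eq_bigr => p _; apply: lF.
Qed.

Lemma linear_tsum_comp (F : V -> W -> U) (g : T -> V ⊗ W) :
  bilinear_for *:%R *:%R F -> linear g ->
  linear (fun x => \tsum_(v, w <- g x) F v w).
Proof. by move=> bF lg c x y /=; rewrite lg tsum_is_linear. Qed.

End TsumParametric.

(* Algebras, coalgebras and bialgebras given by explicit operations on a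
   vector space, so that they apply to the smash (co)products on A ⊗ B. *)

Section Bialgebras.
Variables (k : fieldType) (H : lmodType k).
Variables (mul : H -> H -> H) (one : H).
Variables (Delta : H -> H ⊗ H) (eps : H -> k).

Definition is_algebra : Prop :=
  [/\ forall x, linear (mul x), forall y, linear (mul^~ y),
      associative mul, left_id one mul & right_id one mul].

Definition coassociative : Prop := forall c : H,
  \tsum_(c1, c2 <- Delta c) \tsum_(c11, c12 <- Delta c1) c11 ⊗ c12 ⊗ c2 =
  \tsum_(c1, c2 <- Delta c) \tsum_(c21, c22 <- Delta c2) c1 ⊗ c21 ⊗ c22.

Definition counitary : Prop := forall c : H,
  \tsum_(c1, c2 <- Delta c) eps c1 *: c2 = c /\
  \tsum_(c1, c2 <- Delta c) eps c2 *: c1 = c.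

Definition is_coalgebra : Prop :=
  [/\ linear Delta, scalar eps, coassociative & counitary].

Definition multiplicative_counit : Prop :=
  (forall x y, eps (mul x y) = eps x * eps y) /\ eps one = 1.

Definition grouplike_unit : Prop := Delta one = one ⊗ one /\ eps one = 1.

Definition tmul (V W : lmodType k) (mV : V -> V -> V) (mW : W -> W -> W)
    (t u : V ⊗ W) : V ⊗ W :=
  \tsum_(v, w <- t) \tsum_(v', w' <- u) mV v v' ⊗ mW w w'.

Definition is_bialgebra : Prop :=
  [/\ is_algebra, is_coalgebra,
      forall x y, Delta (mul x y) = tmul mul mul (Delta x) (Delta y),
      Delta one = one ⊗ one & multiplicative_counit].

Section Quasitriangular.
Variable R : H ⊗ H.

Definition R12 : H ⊗ H ⊗ H := \tsum_(r1, r2 <- R) r1 ⊗ r2 ⊗ one.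
Definition R13 : H ⊗ H ⊗ H := \tsum_(r1, r2 <- R) r1 ⊗ one ⊗ r2.
Definition R23 : H ⊗ H ⊗ H := \tsum_(r1, r2 <- R) one ⊗ r1 ⊗ r2.

Definition tmul2 : H ⊗ H -> H ⊗ H -> H ⊗ H :=
  tmul mul mul.
Definition tmul3 :
    H ⊗ H ⊗ H -> H ⊗ H ⊗ H -> H ⊗ H ⊗ H :=
  tmul mul tmul2.

Definition Delta_cop (h : H) : H ⊗ H :=
  \tsum_(h1, h2 <- Delta h) h2 ⊗ h1.

Record quasitriangular : Prop := Quasitriangular {
  qt_counit : \tsum_(r1, r2 <- R) eps r1 *: r2 = one /\
              \tsum_(r1, r2 <- R) eps r2 *: r1 = one;
  qt_Delta_l :
    \tsum_(r1, r2 <- R) \tsum_(r11, r12 <- Delta r1) r11 ⊗ r12 ⊗ r2 =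
    tmul3 R13 R23;
  qt_Delta_r :
    \tsum_(r1, r2 <- R) \tsum_(r21, r22 <- Delta r2) r1 ⊗ r21 ⊗ r22 =
    tmul3 R13 R12;
  qt_cop : forall h, tmul2 R (Delta h) = tmul2 (Delta_cop h) R
}.

End Quasitriangular.
End Bialgebras.

(* A and B are k-algebras in the library's sense, hence nonzero; this is no
   restriction since the counits are algebra maps to k. *)
Section Smash.
Variables (k : fieldType) (A B : algType k).
Variables (DeltaA : A -> A ⊗ A) (epsA : A -> k).
Variables (DeltaB : B -> B ⊗ B) (epsB : B -> k).
Variable sigma : {linear (B ⊗ A)%type -> (A ⊗ B)%type}.
Variable tau : {linear (A ⊗ B)%type -> (B ⊗ A)%type}.

Local Notation H := (A ⊗ B)%type.

Definition smash_mul (x y : H) : H :=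
  \tsum_(a, b <- x) \tsum_(a', b' <- y)
    \tsum_(a's, bs <- sigma (b ⊗ a')) (a * a's) ⊗ (bs * b').

Definition smash_one : H := 1 ⊗ 1.

Definition smash_comul (x : H) : H ⊗ H :=
  \tsum_(a, b <- x) \tsum_(a1, a2 <- DeltaA a) \tsum_(b1, b2 <- DeltaB b)
    \tsum_(b1t, a2t <- tau (a2 ⊗ b1)) (a1 ⊗ b1t) ⊗ (a2t ⊗ b2).

Definition smash_counit (x : H) : k :=
  \tsum_(a, b <- x) (epsA a * epsB b : k^o).

Lemma smash_mul_tens a b a' b' :
  smash_mul (a ⊗ b) (a' ⊗ b') =
  \tsum_(a's, bs <- sigma (b ⊗ a')) (a * a's) ⊗ (bs * b').
Proof.
have bG c d : bilinear_for *:%R *:%R (fun x y => (c * x) ⊗ (y * d) : H).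
  split=> [y|x] e u v /=.
    by rewrite mulrDr -scalerAr linearDl linearZl_LR.
  by rewrite mulrDl -scalerAl linearDr linearZr_LR.
rewrite /smash_mul tsum_tens; last first.
  split=> [b0|a0] /=; apply: linear_tsum => v w.
    apply: linear_tsum => x y c u u' /=.
    by rewrite mulrDl -scalerAl linearDl linearZl_LR.
  apply: linear_tsum_comp => [|c u u']; first exact: bG.
  by rewrite linearDl linearZl_LR linearP.
rewrite tsum_tens //; split=> [b0|a0] /=.
  apply: linear_tsum_comp => [|c u u']; first exact: bG.
  by rewrite linearDr linearZr_LR linearP.
apply: linear_tsum => x y c u u' /=.
by rewrite mulrDr -scalerAr linearDr linearZr_LR.
Qed.

Lemma smash_comul_tens a b : linear DeltaA -> linear DeltaB ->
  smash_comul (a ⊗ b) =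
  \tsum_(a1, a2 <- DeltaA a) \tsum_(b1, b2 <- DeltaB b)
    \tsum_(b1t, a2t <- tau (a2 ⊗ b1)) (a1 ⊗ b1t) ⊗ (a2t ⊗ b2).
Proof.
move=> lA lB.
have bG c d : bilinear_for *:%R *:%R
    (fun x y => (c ⊗ x) ⊗ (y ⊗ d) : H ⊗ H).
  split=> [y|x] e u v /=.
    by rewrite linearDr linearZr_LR linearDl linearZl_LR.
  by rewrite linearDl linearZl_LR linearDr linearZr_LR.
have bB (a1 : A) (a2 : A) : bilinear_for *:%R *:%R (fun b1 b2 : B =>
    \tsum_(b1t, a2t <- tau (a2 ⊗ b1)) ((a1 ⊗ b1t) ⊗ (a2t ⊗ b2) : H ⊗ H)).
  split=> [b2|b1] /=.
    apply: linear_tsum_comp => [|c u u']; first exact: bG.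
    by rewrite linearDr linearZr_LR linearP.
  apply: linear_tsum => x y c u u' /=.
  by rewrite linearDr linearZr_LR linearDr linearZr_LR.
rewrite /smash_comul tsum_tens //; split=> [b0|a0] /=; last first.
  apply: linear_tsum => a1 a2; exact: linear_tsum_comp.
apply: linear_tsum_comp => //; split=> [a2|a1] /=; apply: linear_tsum => b1 b2.
  apply: linear_tsum => x y c u u' /=.
  by rewrite linearDl linearZl_LR linearDl linearZl_LR.
apply: linear_tsum_comp => [|c u u']; first exact: bG.
by rewrite linearDl linearZl_LR linearP.
Qed.

Definition is_smash_product : Prop := is_algebra smash_mul smash_one.

Definition is_smash_coproduct : Prop :=
  is_coalgebra smash_comul smash_counit.

(* The last two clauses are the standing assumption on A and B. *)
Record smash_biproduct_bialgebra : Prop := SmashBiproductBialgebra {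
  sbb_coalgA : is_coalgebra DeltaA epsA;
  sbb_coalgB : is_coalgebra DeltaB epsB;
  sbb_product : is_smash_product;
  sbb_coproduct : is_smash_coproduct;
  sbb_bialgebra :
    is_bialgebra smash_mul smash_one smash_comul smash_counit;
  sbb_counital : multiplicative_counit *%R 1 epsA /\
                 multiplicative_counit *%R 1 epsB;
  sbb_unital : grouplike_unit 1 DeltaA epsA /\ grouplike_unit 1 DeltaB epsB
}.

Definition right_conormal : Prop := forall (a : A) (b : B),
  \tsum_(a_s, b_s <- sigma (b ⊗ a)) epsA a_s *: b_s = epsA a *: b.

Definition left_conormal : Prop := forall (a : A) (b : B),
  \tsum_(a_s, b_s <- sigma (b ⊗ a)) epsB b_s *: a_s = epsB b *: a.

Definition smash_quasitriangular (R : H ⊗ H) : Prop :=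
  quasitriangular smash_mul smash_one smash_comul smash_counit R.

Definition normalized (C D : algType k) (epsC : C -> k) (epsD : D -> k)
    (t : C ⊗ D) : Prop :=
  \tsum_(c, d <- t) epsC c *: d = 1 /\ \tsum_(c, d <- t) epsD d *: c = 1.

Section Components.
Variables (W : B ⊗ B) (X : A ⊗ B).
Variables (Y : B ⊗ A) (Z : A ⊗ A).

Record normalized_components : Prop := NormalizedComponents {
  W_normalized : normalized epsB epsB W;
  X_normalized : normalized epsA epsB X;
  Y_normalized : normalized epsB epsA Y;
  Z_normalized : normalized epsA epsA Z
}.

(* The suffix t stands for the subscript tau.  In the triple tensors ⊗
   associates to the right. *)
Record component_identities : Prop := ComponentIdentities {
  C1 : forall a : A,
    \tsum_(z1, z2 <- Z) \tsum_(a1, a2 <- DeltaA a) (z1 * a1) ⊗ (z2 * a2) =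
    \tsum_(z1, z2 <- Z) \tsum_(a1, a2 <- DeltaA a) (a2 * z1) ⊗ (a1 * z2);
  C2 : forall a : A,
    \tsum_(x1, x2 <- X) (x1 * a) ⊗ x2 =
    \tsum_(x1, x2 <- X) \tsum_(onet, at_ <- tau (a ⊗ 1))
      (at_ * x1) ⊗ (onet * x2);
  C3 : forall a : A,
    \tsum_(y1, y2 <- Y) \tsum_(onet, at_ <- tau (a ⊗ 1))
      (y1 * onet) ⊗ (y2 * at_) =
    \tsum_(y1, y2 <- Y) y1 ⊗ (a * y2);
  C4 : forall b : B,
    \tsum_(z1, z2 <- Z) epsB b *: (z1 ⊗ z2) =
    \tsum_(z1, z2 <- Z) epsB b *: (z1 ⊗ z2);
  C5 : forall b : B,
    \tsum_(x1, x2 <- X) x1 ⊗ (x2 * b) =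
    \tsum_(x1, x2 <- X) \tsum_(bt, onet <- tau (1 ⊗ b))
      (onet * x1) ⊗ (bt * x2);
  C6 : forall b : B,
    \tsum_(y1, y2 <- Y) \tsum_(bt, onet <- tau (1 ⊗ b))
      (y1 * bt) ⊗ (y2 * onet) =
    \tsum_(y1, y2 <- Y) (b * y1) ⊗ y2;
  C7 : forall b : B,
    \tsum_(w1, w2 <- W) \tsum_(b1, b2 <- DeltaB b) (w1 * b1) ⊗ (w2 * b2) =
    \tsum_(w1, w2 <- W) \tsum_(b1, b2 <- DeltaB b) (b2 * w1) ⊗ (b1 * w2);
  C8 :
    \tsum_(z1, z2 <- Z) \tsum_(z11, z12 <- DeltaA z1) z11 ⊗ z12 ⊗ z2 =
    \tsum_(z1, z2 <- Z) \tsum_(z1', z2' <- Z) z1 ⊗ z1' ⊗ (z2 * z2');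
  C9 :
    \tsum_(x1, x2 <- X) \tsum_(x11, x12 <- DeltaA x1) x11 ⊗ x12 ⊗ x2 =
    \tsum_(x1, x2 <- X) \tsum_(x1', x2' <- X) x1 ⊗ x1' ⊗ (x2 * x2');
  C10 :
    \tsum_(y1, y2 <- Y) \tsum_(z1, z2 <- Z)
      \tsum_(y1t, z1t <- tau (z1 ⊗ y1)) y1t ⊗ z1t ⊗ (z2 * y2) =
    \tsum_(y1, y2 <- Y) \tsum_(z1, z2 <- Z) y1 ⊗ z1 ⊗ (y2 * z2);
  C11 :
    \tsum_(w1, w2 <- W) \tsum_(x1, x2 <- X)
      \tsum_(w1t, x1t <- tau (x1 ⊗ w1)) w1t ⊗ x1t ⊗ (x2 * w2) =
    \tsum_(w1, w2 <- W) \tsum_(x1, x2 <- X) w1 ⊗ x1 ⊗ (w2 * x2);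
  C12 :
    \tsum_(y1, y2 <- Y) \tsum_(y11, y12 <- DeltaB y1) y11 ⊗ y12 ⊗ y2 =
    \tsum_(y1, y2 <- Y) \tsum_(y1', y2' <- Y) y1 ⊗ y1' ⊗ (y2 * y2');
  C13 :
    \tsum_(w1, w2 <- W) \tsum_(w11, w12 <- DeltaB w1) w11 ⊗ w12 ⊗ w2 =
    \tsum_(w1, w2 <- W) \tsum_(w1', w2' <- W) w1 ⊗ w1' ⊗ (w2 * w2');
  C14 :
    \tsum_(z1, z2 <- Z) \tsum_(z21, z22 <- DeltaA z2) z1 ⊗ z21 ⊗ z22 =
    \tsum_(z1, z2 <- Z) \tsum_(z1', z2' <- Z) (z1 * z1') ⊗ z2' ⊗ z2;
  C15 :
    \tsum_(z1, z2 <- Z) \tsum_(x1, x2 <- X)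
      \tsum_(onet1, z1t1 <- tau (z1 ⊗ 1))
      \tsum_(bt2, z2t2 <- tau (z2 ⊗ (onet1 * x2)))
        (z1t1 * x1) ⊗ bt2 ⊗ z2t2 =
    \tsum_(z1, z2 <- Z) \tsum_(x1, x2 <- X) (z1 * x1) ⊗ x2 ⊗ z2;
  C16 :
    \tsum_(x1, x2 <- X) \tsum_(x21, x22 <- DeltaB x2) x1 ⊗ x21 ⊗ x22 =
    \tsum_(x1, x2 <- X) \tsum_(x1', x2' <- X) (x1 * x1') ⊗ x2' ⊗ x2;
  C17 :
    \tsum_(y1, y2 <- Y) \tsum_(y21, y22 <- DeltaA y2) y1 ⊗ y21 ⊗ y22 =
    \tsum_(y1, y2 <- Y) \tsum_(y1', y2' <- Y) (y1 * y1') ⊗ y2' ⊗ y2;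
  C18 :
    \tsum_(w1, w2 <- W) \tsum_(y1, y2 <- Y)
      \tsum_(w2t, y2t <- tau (y2 ⊗ w2)) (w1 * y1) ⊗ w2t ⊗ y2t =
    \tsum_(w1, w2 <- W) \tsum_(y1, y2 <- Y) (y1 * w1) ⊗ w2 ⊗ y2;
  C19 :
    \tsum_(w1, w2 <- W) \tsum_(w21, w22 <- DeltaB w2) w1 ⊗ w21 ⊗ w22 =
    \tsum_(w1, w2 <- W) \tsum_(w1', w2' <- W) (w1 * w1') ⊗ w2' ⊗ w2
}.

Definition alpha : H ⊗ H :=
  \tsum_(z1, z2 <- Z) \tsum_(x1, x2 <- X)
  \tsum_(y1, y2 <- Y) \tsum_(w1, w2 <- W)
  \tsum_(onet, z1t <- tau (z1 ⊗ 1))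
    ((z1t * x1) ⊗ (w1 * y1)) ⊗ ((z2 * y2) ⊗ (onet * x2 * w2)).

End Components.
End Smash.

(* Main.v *)
Require Import Defs.
From HB Require Import structures.
From mathcomp Require Import all_boot all_order all_algebra.
From mathcomp Require Import boolp classical_sets.

Set Implicit Arguments.
Unset Strict Implicit.
Unset Printing Implicit Defensive.

Import GRing.Theory.
Local Open Scope ring_scope.

(** Write [H] for the smash biproduct, [p = id ⊗ epsB] and [q = epsA ⊗ id] for
its projections onto [A] and [B].

Conormality of [sigma] says exactly that [p] and [q] are multiplicative for the
smash product.  The counit axiom of the smash coproduct forces
[(p ⊗ q) Delta = id], hence every product in [H] can be computed after applying
[p ⊗ q] to the product of the coproducts, that is, in the ordinary tensor
product algebra: [sigma] is the flip and [H] is [A ⊗ B] as an algebra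
([smash_mulE]).  The same counit axiom gives [(p ⊗ p) Delta = DeltaA p],
[(q ⊗ q) Delta = DeltaB q] and [(q ⊗ p) Delta = tau]; in particular [tau] is an
algebra map ([tau_alg_hom]).

A quasitriangular structure [R] is then cut into its four images
[Z = (p ⊗ p) R], [X = (p ⊗ q) R], [Y = (q ⊗ p) R], [W = (q ⊗ q) R].  Applying
[p] and [q] in all possible ways to the three legs of
[(Delta ⊗ id) R = R13 R23] and [(id ⊗ Delta) R = R13 R12], and to the two legs
of [R Delta(h) = Delta^cop(h) R], produces all the required identities; and
applying [Delta ⊗ Delta] to [R] and then [p ⊗ q ⊗ p ⊗ q] gives
[R = X14 Z13 W24 Y23] ([four_legs_image]), which is [alpha] once [Z1] has been
moved across [X] by means of [tau].

Conversely [X14 Z13 W24 Y23] is quasitriangular as soon as the identities hold: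
[Delta] splits each of its factors into two by the coproduct identities, and the
identities with [tau] put the eight resulting factors back in order
([assembled_splits_left], [assembled_splits_right]); a coproduct is carried
across the four factors one at a time ([assembled_intertwines_cop]).

All these computations are made in leg notation, in which the embeddings of the
tensor factors are replaced by arbitrary maps into an algebra ([legs]).  An
identity in a threefold tensor product holds if and only if its leg form holds
for all triples of commuting algebra maps into all algebras [M], and the leg
forms are what is proved and used: composing the maps with [p], [q] or a
coproduct is substitution in them. *)

(** * Linear maps out of tensor products *)

Section LinearOnTensors.
Variables (k : fieldType).
Implicit Types U V W : lmodType k.

Lemma linear_fun0 U V (f : U -> V) : linear f -> f 0 = 0.
Proof.
by move=> lf; have := lf (-1) 0 0; rewrite scaler0 addr0 scaleN1r addNr.
Qed.

Lemma linear_funD U V (f : U -> V) : linear f -> {morph f : x y / x + y}.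
Proof. by move=> lf x y; have := lf 1 x y; rewrite !scale1r. Qed.

Lemma linear_funZ U V (f : U -> V) :
  linear f -> forall c, {morph f : x / c *: x}.
Proof.
by move=> lf c x; have := lf c x 0; rewrite !addr0 (linear_fun0 lf) addr0.
Qed.

Lemma linear_fun_comp U V W (f : V -> W) (g : U -> V) :
  linear f -> linear g -> linear (f \o g).
Proof. by move=> lf lg c x y /=; rewrite lg lf. Qed.

Lemma linear_tsumE U U' V W (f : U -> U') (F : V -> W -> U) (t : V ⊗ W) :
  linear f -> f (\tsum_(v, w <- t) F v w) = \tsum_(v, w <- t) f (F v w).
Proof. by move=> lf; exact: (big_morph f (linear_funD lf) (linear_fun0 lf)). Qed.

Lemma eq_tsum U V W (F G : V -> W -> U) (t : V ⊗ W) :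
  (forall v w, F v w = G v w) -> tsum F t = tsum G t.
Proof. by move=> FG; apply: eq_bigr => p _. Qed.

Lemma tensor_ext U V W (f g : (V ⊗ W)%type -> U) :
  linear f -> linear g -> (forall v w, f (v ⊗ w) = g (v ⊗ w)) -> f =1 g.
Proof.
move=> lf lg fg t; rewrite [t]tensE (linear_tsumE _ _ lf) (linear_tsumE _ _ lg).
exact: eq_tsum.
Qed.

(** A subspace maximal among those avoiding [e] is a hyperplane complementary to
the line of [e], so it is the kernel of the functional.  This is needed to know
that the tensor product of two nonzero algebras is nonzero. *)
Lemma exists_functional V (e : V) :
  e <> 0 -> exists phi : V -> k, scalar phi /\ phi e = 1.
Proof.
move=> e0.
(* Sets that are subspaces once zero is added: unlike subspaces, they include the
   union of the empty chain. *)
pose sub0 (S : set V) x := S x \/ x = 0.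
pose avoids (S : set V) :=
  (forall c x y, sub0 S x -> sub0 S y -> sub0 S (c *: x + y)) /\ ~ S e.
have [F Fav Ftot|S [[Slin Se] Smax]] := @Zorn_bigcup V avoids.
  split=> [c x y|[X FX Xe]]; last by case: (Fav X FX) => _; apply.
  have inF X z : F X -> sub0 X z -> sub0 (\bigcup_(X in F) X)%classic z.
    by move=> FX [Xz|]; [left; exists X|right].
  have addF X z z' : F X -> sub0 X z -> sub0 X z' ->
      sub0 (\bigcup_(X in F) X)%classic (c *: z + z').
    by move=> FX Xz Xz'; apply: (inF X) => //; case: (Fav X FX) => + _; apply.
  case=> [[X FX Xx]|->]; case=> [[Y FY Yy]|->].
  - case: (Ftot X Y FX FY) => XY.
      by apply: (addF Y) => //; left => //; apply: XY.
    by apply: (addF X) => //; left => //; apply: XY.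
  - by apply: (addF X) => //; [left|right].
  - by apply: (addF Y) => //; [right|left].
  - by right; rewrite scaler0 addr0.
have S0e : ~ sub0 S e by case.
have coef a : exists c, sub0 S (a - c *: e).
  have [Sa|Sa] := pselect (sub0 S a); first by exists 0; rewrite scale0r subr0.
  pose Sk x := exists c w, sub0 S w /\ x = w + c *: a.
  have Sk_lin c x y : Sk x -> Sk y -> Sk (c *: x + y).
    move=> [d [w [Sw ->]]] [d' [w' [Sw' ->]]].
    exists (c * d + d'), (c *: w + w'); split; first exact: Slin.
    by rewrite scalerDr scalerA scalerDl addrACA.
  have Sk0 : Sk 0 by exists 0, 0; split; [right|rewrite scale0r addr0].
  have Ske : Sk e.
    have SSk : (S `<` (Sk : set V))%classic.
      split=> [x Sx|SkS].
        by exists 0, x; split; [left|rewrite scale0r addr0].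
      apply: Sa; left; apply: SkS; exists 1, 0.
      by split; [right|rewrite scale1r add0r].
    apply: contra_notP (Smax _ SSk) => nSke; split => // c x y Skx Sky; left.
    by apply: Sk_lin; [case: Skx => // ->|case: Sky => // ->].
  have [c [w [Sw ew]]] := Ske.
  have c0 : c != 0 by apply/eqP => c0; apply: S0e; rewrite ew c0 scale0r addr0.
  exists c^-1; rewrite ew scalerDr scalerA mulVf // scale1r opprD.
  rewrite addrCA addrN addr0.
  by rewrite -scaleNr -[_ *: w]addr0; apply: Slin => //; right.
have [phi phiP] := choice coef.
have uniq a c : sub0 S (a - c *: e) -> phi a = c.
  move=> Sc; apply/eqP; rewrite -subr_eq0; apply/eqP.
  apply: contra_notP S0e => /eqP d0.
  have := Slin (-1) _ _ (phiP a) Sc.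
  rewrite scaleN1r opprB addrA subrK -scalerBl => Sd.
  have := Slin (phi a - c)^-1 _ _ Sd (or_intror erefl).
  by rewrite scalerA mulVf // scale1r addr0.
exists phi; split=> [c x y|]; last by apply: uniq; rewrite scale1r subrr; right.
apply: uniq; have := Slin c _ _ (phiP x) (phiP y).
by rewrite scalerBr scalerA scalerDl opprD addrACA.
Qed.

End LinearOnTensors.

(** * The tensor product of two algebras *)

Section TensorAlgebra.
Variables (k : fieldType) (C D : algType k).
Local Notation T := (C ⊗ D)%type.
Let m : T -> T -> T := tmul *%R *%R.

Let bil (a : C) (b : D) :
  bilinear_for *:%R *:%R (fun c d => (a * c) ⊗ (b * d)).
Proof.
by split=> [d|c] e u v /=; rewrite mulrDr -scalerAr ?linearDl ?linearZl_LR
  ?linearDr ?linearZr_LR.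
Qed.

Let bil2 y : bilinear_for *:%R *:%R
  (fun (c : C) (d : D) => \tsum_(c', d' <- y) (c * c') ⊗ (d * d')).
Proof.
by split=> [d|c]; apply: linear_tsum => c' d' e u v;
  rewrite mulrDl -scalerAl ?linearDl ?linearZl_LR ?linearDr ?linearZr_LR.
Qed.

Let m_linr x : linear (m x).
Proof.
move=> c u v; rewrite /m /tmul /tsum scaler_sumr -big_split /=.
by apply: eq_bigr => p _; apply: (tsum_is_linear (bil _ _)).
Qed.

Let m_linl y : linear (m^~ y).
Proof. by move=> c u v; apply: (tsum_is_linear (bil2 y)). Qed.

Let m_tens a b c d : m (a ⊗ b) (c ⊗ d) = (a * c) ⊗ (b * d).
Proof. by rewrite /m /tmul (tsum_tens (bil2 _)) (tsum_tens (bil _ _)). Qed.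

Let mA : associative m.
Proof.
move=> x y z.
apply: (tensor_ext (f := fun x => m x (m y z)) (g := fun x => m (m x y) z)).
- exact: m_linl.
- by move=> c u v; rewrite !m_linl.
move=> a b {x}.
apply: (tensor_ext (f := fun y => m (a ⊗ b) (m y z))
                   (g := fun y => m (m (a ⊗ b) y) z)).
- by move=> c u v; rewrite m_linl m_linr.
- by move=> c u v; rewrite m_linr m_linl.
move=> a' b' {y}.
apply: (tensor_ext (f := fun z => m (a ⊗ b) (m (a' ⊗ b') z))
                   (g := m (m (a ⊗ b) (a' ⊗ b')))).
- by move=> c u v; rewrite !m_linr.
- exact: m_linr.
by move=> a'' b''; rewrite !m_tens !mulrA.
Qed.

Let m1l : left_id (1 ⊗ 1) m.
Proof.
move=> x; apply: (tensor_ext (f := m (1 ⊗ 1)) (g := id)) => // a b.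
by rewrite m_tens !mul1r.
Qed.

Let m1r : right_id (1 ⊗ 1) m.
Proof.
move=> x; apply: (tensor_ext (f := m^~ (1 ⊗ 1)) (g := id)) => // a b.
by rewrite m_tens !mulr1.
Qed.

Let mDl : left_distributive m +%R.
Proof. by move=> x y z; apply: (linear_funD (m_linl z)). Qed.
Let mDr : right_distributive m +%R.
Proof. by move=> z x y; apply: (linear_funD (m_linr z)). Qed.

Let nonzero : 1 ⊗ 1 != 0 :> T.
Proof.
have [phi [lphi phi1]] := exists_functional (elimN eqP (oner_neq0 C)).
have [psi [lpsi psi1]] := exists_functional (elimN eqP (oner_neq0 D)).
have bF : bilinear_for *:%R *:%R (fun c d => phi c * psi d : k^o).
  split=> [d|c] e u v /=; first by rewrite lphi mulrDl -mulrA.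
  by rewrite lpsi mulrDr mulrCA.
apply/eqP => /(congr1 (tsum (fun c d => phi c * psi d : k^o))).
rewrite tsum_tens // (linear_fun0 (tsum_is_linear bF)) phi1 psi1 mulr1.
by apply/eqP; rewrite oner_eq0.
Qed.

HB.instance Definition _ :=
  GRing.Zmodule_isNzRing.Build T mA m1l m1r mDl mDr nonzero.

Let sAl (c : k) (x y : T) : c *: (x * y) = c *: x * y.
Proof. by symmetry; apply: (linear_funZ (m_linl y)). Qed.
Let sAr (c : k) (x y : T) : c *: (x * y) = x * (c *: y).
Proof. by symmetry; apply: (linear_funZ (m_linr x)). Qed.

HB.instance Definition _ := GRing.Lmodule_isLalgebra.Build k T sAl.
HB.instance Definition _ := GRing.Lalgebra_isAlgebra.Build k T sAr.

Lemma mul_tens (a c : C) (b d : D) :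
  (a ⊗ b) * (c ⊗ d) = (a * c) ⊗ (b * d).
Proof. exact: m_tens. Qed.

End TensorAlgebra.

(** * Legs of a tensor in an algebra *)

Definition alg_hom (k : fieldType) (C M : algType k) (f : C -> M) : Prop :=
  linear f /\ monoid_morphism f.

Definition commuting (S T : Type) (M : pzRingType)
    (f : S -> M) (g : T -> M) : Prop :=
  forall x y, f x * g y = g y * f x.

(** With [f] and [g] the embeddings of the i-th and j-th factors in a tensor
product, this is the element usually written [t_ij]. *)
Definition legs (k : fieldType) (V W : lmodType k) (M : algType k)
  (f : V -> M) (g : W -> M) (t : V ⊗ W) : M := \tsum_(v, w <- t) f v * g w.

Section Legs.
Variables (k : fieldType) (M : algType k).
Implicit Types U V W : lmodType k.

Lemma legsE V W (f : V -> M) (g : W -> M) t :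
  legs f g t = \tsum_(v, w <- t) f v * g w.
Proof. by []. Qed.

Lemma legs_bilinear V W (f : V -> M) (g : W -> M) :
  linear f -> linear g -> bilinear_for *:%R *:%R (fun v w => f v * g w).
Proof.
by move=> lf lg; split=> [w|v] c x y;
  rewrite ?lf ?lg ?mulrDl ?mulrDr -?scalerAl -?scalerAr.
Qed.

Lemma legs_linear V W (f : V -> M) (g : W -> M) :
  linear f -> linear g -> linear (legs f g).
Proof. by move=> lf lg; apply/tsum_is_linear/legs_bilinear. Qed.

Lemma legs_tens V W (f : V -> M) (g : W -> M) v w :
  linear f -> linear g -> legs f g (v ⊗ w) = f v * g w.
Proof. by move=> lf lg; rewrite /legs tsum_tens //; apply: legs_bilinear. Qed.

Lemma legs_tsum V W V' W' (f : V -> M) (g : W -> M)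
    (F : V' -> W' -> V ⊗ W) t :
  linear f -> linear g ->
  legs f g (tsum F t) = \tsum_(v, w <- t) legs f g (F v w).
Proof. by move=> lf lg; apply/linear_tsumE/legs_linear. Qed.

Lemma eq_legs V W (f f' : V -> M) (g g' : W -> M) t :
  f =1 f' -> g =1 g' -> legs f g t = legs f' g' t.
Proof. by move=> ff gg; apply: eq_tsum => v w; rewrite ff gg. Qed.

Lemma tsum_mull V W (x : M) (F : V -> W -> M) t :
  x * tsum F t = \tsum_(v, w <- t) x * F v w.
Proof. exact: mulr_sumr. Qed.

Lemma tsum_mulr V W (x : M) (F : V -> W -> M) t :
  tsum F t * x = \tsum_(v, w <- t) F v w * x.
Proof. exact: mulr_suml. Qed.

Lemma exchange_tsum U V W V' W' (F : V -> W -> V' -> W' -> U) t t' :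
  \tsum_(v, w <- t) \tsum_(v', w' <- t') F v w v' w' =
  \tsum_(v', w' <- t') \tsum_(v, w <- t) F v w v' w'.
Proof. exact: exchange_big. Qed.

Lemma commuting_sym (S T : Type) (f : S -> M) (g : T -> M) :
  commuting f g -> commuting g f.
Proof. by move=> fg x y; rewrite fg. Qed.

Lemma commuting_compl (S S' T : Type) (h : S' -> S) (f : S -> M) (g : T -> M) :
  commuting f g -> commuting (f \o h) g.
Proof. by move=> fg x y; apply: fg. Qed.

Lemma commuting_compr (S T T' : Type) (h : T' -> T) (f : S -> M) (g : T -> M) :
  commuting f g -> commuting f (g \o h).
Proof. by move=> fg x y; apply: fg. Qed.

Lemma commuting_legsl (S : Type) V W (f : V -> M) (g : W -> M) (h : S -> M) :
  commuting f h -> commuting g h -> commuting (legs f g) h.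
Proof.
move=> fh gh t x; rewrite /legs tsum_mull tsum_mulr; apply: eq_tsum => v w.
by rewrite -mulrA gh !mulrA fh.
Qed.

Lemma commuting_legsr (S : Type) V W (f : V -> M) (g : W -> M) (h : S -> M) :
  commuting h f -> commuting h g -> commuting h (legs f g).
Proof.
by move=> hf hg; apply/commuting_sym/commuting_legsl; apply: commuting_sym.
Qed.

Lemma alg_hom_linear (C : algType k) (f : C -> M) : alg_hom f -> linear f.
Proof. by case. Qed.

Lemma alg_homM (C : algType k) (f : C -> M) :
  alg_hom f -> {morph f : x y / x * y}.
Proof. by case=> _ [_]. Qed.

Lemma alg_hom1 (C : algType k) (f : C -> M) : alg_hom f -> f 1 = 1.
Proof. by case=> _ []. Qed.

Lemma alg_hom_comp (C D : algType k) (f : D -> M) (g : C -> D) :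
  alg_hom f -> alg_hom g -> alg_hom (f \o g).
Proof.
move=> [lf [f1 fM]] [lg [g1 gM]]; split; first exact: linear_fun_comp.
by split=> [|x y] /=; rewrite ?g1 ?gM ?f1 ?fM.
Qed.

Lemma alg_hom_id : alg_hom (@id M). Proof. by []. Qed.

(** The multiplications of [V] and [W] are arbitrary because this is applied to
the smash product before it is known to be the ordinary one. *)
Lemma legs_tmul V W (mV : V -> V -> V) (mW : W -> W -> W)
    (f : V -> M) (g : W -> M) t u :
  linear f -> linear g ->
  (forall x y, f (mV x y) = f x * f y) ->
  (forall x y, g (mW x y) = g x * g y) ->
  commuting f g ->
  legs f g (tmul mV mW t u) = legs f g t * legs f g u.
Proof.
move=> lf lg fM gM fg; rewrite legs_tsum // {2}/legs tsum_mulr.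
apply: eq_tsum => v w; rewrite legs_tsum // {2}/legs tsum_mull.
apply: eq_tsum => v' w'; rewrite legs_tens // fM gM -!mulrA; congr (_ * _).
by rewrite !mulrA fg.
Qed.

Lemma legs_alg_hom (C D : algType k) (f : C -> M) (g : D -> M) :
  alg_hom f -> alg_hom g -> commuting f g -> alg_hom (legs f g).
Proof.
move=> hf hg fg; have [lf [f1 fM]] := hf; have [lg [g1 gM]] := hg.
split; first exact: legs_linear.
split=> [|x y]; first by rewrite legs_tens // f1 g1 mulr1.
exact: legs_tmul.
Qed.

Lemma alg_hom_legs (N : algType k) V W
    (f : V -> M) (g : W -> M) (h : M -> N) t :
  alg_hom h -> h (legs f g t) = legs (h \o f) (h \o g) t.
Proof.
move=> [lh [_ hM]]; rewrite /legs linear_tsumE //.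
by apply: eq_tsum => v w; rewrite hM.
Qed.

End Legs.

Definition inl_t (k : fieldType) (C D : algType k) (c : C) : (C ⊗ D)%type :=
  c ⊗ 1.
Definition inr_t (k : fieldType) (C D : algType k) (d : D) : (C ⊗ D)%type :=
  1 ⊗ d.
Arguments inl_t {k C D}.
Arguments inr_t {k C D}.

Section Embeddings.
Variables (k : fieldType) (C D : algType k).

Lemma inl_alg_hom : alg_hom (@inl_t k C D).
Proof.
split=> [c x y|]; first by rewrite /inl_t linearDl linearZl_LR.
by split=> [|x y] //; rewrite /inl_t mul_tens mulr1.
Qed.

Lemma inr_alg_hom : alg_hom (@inr_t k C D).
Proof.
split=> [c x y|]; first by rewrite /inr_t linearDr linearZr_LR.
by split=> [|x y] //; rewrite /inr_t mul_tens mulr1.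
Qed.

Lemma commuting_inlr : commuting (@inl_t k C D) inr_t.
Proof. by move=> x y; rewrite !mul_tens !mul1r !mulr1. Qed.

Lemma commuting_inrl : commuting (@inr_t k C D) inl_t.
Proof. exact/commuting_sym/commuting_inlr. Qed.

Lemma legs_inlr (t : C ⊗ D) : legs inl_t inr_t t = t.
Proof.
rewrite [RHS]tensE; apply: eq_tsum => c d.
by rewrite mul_tens mul1r mulr1.
Qed.

End Embeddings.

Lemma commuting_comp2 (k : fieldType) (S T : Type) (M N : algType k)
    (h : M -> N) (f : S -> M) (g : T -> M) :
  alg_hom h -> commuting f g -> commuting (h \o f) (h \o g).
Proof. by move=> [_ [_ hM]] fg x y /=; rewrite -!hM fg. Qed.

(** Discharges the linearity, multiplicativity and commutation conditions on maps
built from given ones by composition, embedding and [legs]. *)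
Ltac homs :=
  lazymatch goal with
  | |- alg_hom _ => first
      [ assumption
      | exact: inl_alg_hom | exact: inr_alg_hom | exact: alg_hom_id
      | lazymatch goal with
        | |- alg_hom (legs _ _) => apply: legs_alg_hom; homs
        | |- alg_hom (_ \o _) => apply: alg_hom_comp; homs
        end ]
  | |- commuting _ _ => first
      [ assumption | apply: commuting_sym; assumption
      | exact: commuting_inlr | exact: commuting_inrl
      | lazymatch goal with
        | |- commuting (legs _ _) _ => apply: commuting_legsl; homs
        | |- commuting _ (legs _ _) => apply: commuting_legsr; homs
        | |- commuting (_ \o _) (_ \o _) =>
          first [ apply: commuting_comp2; homs | apply: commuting_compl; homs
                | apply: commuting_compr; homs ]
        | |- commuting (_ \o _) _ => apply: commuting_compl; homs
        | |- commuting _ (_ \o _) => apply: commuting_compr; homs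
        end ]
  | |- GRing.linear_for _ _ => first
      [ assumption
      | lazymatch goal with
        | |- GRing.linear_for _ (legs _ _) => apply: legs_linear; homs
        | |- GRing.linear_for _ (_ \o _) => apply: linear_fun_comp; homs
        | |- _ => apply: alg_hom_linear; homs
        end ]
  end.

(** * Leg forms of the coproduct identities *)

Section TripleLegs.
Variables (k : fieldType).

Definition commuting_homs (C D E M : algType k)
    (f : C -> M) (g : D -> M) (h : E -> M) :=
  [/\ alg_hom f, alg_hom g & alg_hom h] /\
  [/\ commuting f g, commuting f h & commuting g h].

Lemma legs3_tens (M : algType k) (U V W : lmodType k)
    (f : U -> M) (g : V -> M) (h : W -> M) u v w :
  linear f -> linear g -> linear h ->
  legs f (legs g h) (u ⊗ v ⊗ w) = f u * g v * h w.
Proof. by move=> lf lg lh; rewrite !legs_tens ?mulrA //; homs. Qed.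

Variables C D E : algType k.
Local Notation e1 := (@inl_t k C (D ⊗ E)%type).
Local Notation e2 := (@inr_t k C (D ⊗ E)%type \o inl_t).
Local Notation e3 := (@inr_t k C (D ⊗ E)%type \o inr_t).

Lemma embeddings_commuting : commuting_homs e1 e2 e3.
Proof. by split; split; homs. Qed.

(** Evaluating a leg form at the three embeddings gives back the identity in the
threefold tensor product, so that the leg form is not weaker than it. *)
Lemma legs3_embeddings (t : C ⊗ D ⊗ E) : legs e1 (legs e2 e3) t = t.
Proof.
rewrite -[RHS]legs_inlr; apply: eq_tsum => c d /=.
rewrite -alg_hom_legs; last exact: inr_alg_hom.
by rewrite legs_inlr /inl_t mul_tens mul1r mulr1.
Qed.

End TripleLegs.

Section Splits.
Variables (k : fieldType) (C D : algType k).

(** Leg form of [(Delta ⊗ id) t = t13 t23]. *)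
Definition splits_left (Delta : C -> C ⊗ C) (t : C ⊗ D) :=
  forall (M : algType k) (f g : C -> M) (h : D -> M), commuting_homs f g h ->
    legs (legs f g \o Delta) h t = legs f h t * legs g h t.

Lemma splits_leftP (Delta : C -> C ⊗ C) (t : C ⊗ D) :
  \tsum_(c, d <- t) \tsum_(c1, c2 <- Delta c) c1 ⊗ c2 ⊗ d =
  \tsum_(c, d <- t) \tsum_(c', d' <- t) c ⊗ c' ⊗ (d * d') <->
  splits_left Delta t.
Proof.
have lhsE (M : algType k) (f g : C -> M) (h : D -> M) : commuting_homs f g h ->
    legs f (legs g h)
      (\tsum_(c, d <- t) \tsum_(c1, c2 <- Delta c) c1 ⊗ c2 ⊗ d) =
    legs (legs f g \o Delta) h t.
  move=> [[hf hg hh] _]; rewrite legs_tsum; try homs; apply: eq_tsum => c d /=.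
  rewrite legs_tsum; try homs; rewrite [legs f g _]legsE tsum_mulr.
  apply: eq_tsum => c1 c2.
  by rewrite legs3_tens; try homs.
have rhsE (M : algType k) (f g : C -> M) (h : D -> M) : commuting_homs f g h ->
    legs f (legs g h)
      (\tsum_(c, d <- t) \tsum_(c', d' <- t) c ⊗ c' ⊗ (d * d')) =
    legs f h t * legs g h t.
  move=> [[hf hg hh] [_ _ gh]]; rewrite legs_tsum; try homs.
  rewrite [legs f h _]legsE tsum_mulr; apply: eq_tsum => c d /=.
  rewrite legs_tsum; try homs; rewrite [legs g h _]legsE tsum_mull.
  apply: eq_tsum => c1 c2.
  rewrite legs3_tens; try homs; rewrite (alg_homM hh) -!mulrA; congr (_ * _).
  by rewrite !mulrA gh.
split=> [tE M f g h fgh|U]; first by rewrite -lhsE // -rhsE // tE.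
have := U _ _ _ _ (embeddings_commuting C C D).
by rewrite -lhsE -?rhsE ?legs3_embeddings //; apply: embeddings_commuting.
Qed.

(** Leg form of [(id ⊗ Delta) t = t13 t12]. *)
Definition splits_right (Delta : D -> D ⊗ D) (t : C ⊗ D) :=
  forall (M : algType k) (f : C -> M) (g h : D -> M), commuting_homs f g h ->
    legs f (legs g h \o Delta) t = legs f h t * legs f g t.

Lemma splits_rightP (Delta : D -> D ⊗ D) (t : C ⊗ D) :
  \tsum_(c, d <- t) \tsum_(d1, d2 <- Delta d) c ⊗ d1 ⊗ d2 =
  \tsum_(c, d <- t) \tsum_(c', d' <- t) (c * c') ⊗ d' ⊗ d <->
  splits_right Delta t.
Proof.
have lhsE (M : algType k) (f : C -> M) (g h : D -> M) : commuting_homs f g h ->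
    legs f (legs g h)
      (\tsum_(c, d <- t) \tsum_(d1, d2 <- Delta d) c ⊗ d1 ⊗ d2) =
    legs f (legs g h \o Delta) t.
  move=> [[hf hg hh] _]; rewrite legs_tsum; try homs; apply: eq_tsum => c d /=.
  rewrite legs_tsum; try homs; rewrite [legs g h _]legsE tsum_mull.
  apply: eq_tsum => d1 d2.
  by rewrite legs3_tens ?mulrA; try homs.
have rhsE (M : algType k) (f : C -> M) (g h : D -> M) : commuting_homs f g h ->
    legs f (legs g h)
      (\tsum_(c, d <- t) \tsum_(c', d' <- t) (c * c') ⊗ d' ⊗ d) =
    legs f h t * legs f g t.
  move=> [[hf hg hh] [_ fh gh]]; rewrite legs_tsum; try homs.
  rewrite [legs f h _]legsE tsum_mulr; apply: eq_tsum => c d /=.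
  rewrite legs_tsum; try homs; rewrite [legs f g _]legsE tsum_mull.
  apply: eq_tsum => c1 d1.
  rewrite legs3_tens; try homs; rewrite (alg_homM hf) -!mulrA; congr (_ * _).
  by rewrite gh !mulrA fh.
split=> [tE M f g h fgh|U]; first by rewrite -lhsE // -rhsE // tE.
have := U _ _ _ _ (embeddings_commuting C D D).
by rewrite -lhsE -?rhsE ?legs3_embeddings //; apply: embeddings_commuting.
Qed.

End Splits.

Section LegsProducts.
Variables (k : fieldType) (C D : algType k).
Variables (M : algType k) (f : C -> M) (g : D -> M).
Hypotheses (hf : alg_hom f) (hg : alg_hom g) (fg : commuting f g).

Lemma legs_mul (t s : C ⊗ D) :
  legs f g (\tsum_(x, y <- t) \tsum_(x', y' <- s) (x * x') ⊗ (y * y')) =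
  legs f g t * legs f g s.
Proof. by rewrite -(alg_homM (legs_alg_hom hf hg fg)). Qed.

Lemma legs_flip_mul (t : C ⊗ D) (s : D ⊗ C) :
  legs f g (\tsum_(x, y <- t) \tsum_(y', x' <- s) (x' * x) ⊗ (y' * y)) =
  legs g f s * legs f g t.
Proof.
rewrite exchange_tsum legs_tsum; try homs; rewrite [legs g f _]legsE tsum_mulr.
apply: eq_tsum => y' x'; rewrite legs_tsum; try homs.
rewrite [in RHS]legsE tsum_mull.
apply: eq_tsum => x y; rewrite legs_tens; try homs.
rewrite (alg_homM hf) (alg_homM hg) -fg -!mulrA; congr (_ * _).
by rewrite !mulrA fg.
Qed.

Lemma legs_mull (t : C ⊗ D) c :
  legs f g (\tsum_(x, y <- t) (c * x) ⊗ y) = f c * legs f g t.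
Proof.
rewrite legs_tsum; try homs; rewrite [in RHS]legsE tsum_mull.
apply: eq_tsum => x y.
by rewrite legs_tens; try homs; rewrite (alg_homM hf) mulrA.
Qed.

Lemma legs_mulr (t : C ⊗ D) d :
  legs f g (\tsum_(x, y <- t) x ⊗ (y * d)) = legs f g t * g d.
Proof.
rewrite legs_tsum; try homs; rewrite [in RHS]legsE tsum_mulr.
apply: eq_tsum => x y.
by rewrite legs_tens; try homs; rewrite (alg_homM hg) mulrA.
Qed.

Lemma legs_mulrl (t : C ⊗ D) c :
  legs f g (\tsum_(x, y <- t) (x * c) ⊗ y) = legs f g t * f c.
Proof.
rewrite legs_tsum; try homs; rewrite [in RHS]legsE tsum_mulr.
apply: eq_tsum => x y.
by rewrite legs_tens; try homs; rewrite (alg_homM hf) -!mulrA fg.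
Qed.

Lemma legs_mullr (t : C ⊗ D) d :
  legs f g (\tsum_(x, y <- t) x ⊗ (d * y)) = g d * legs f g t.
Proof.
rewrite legs_tsum; try homs; rewrite [in RHS]legsE tsum_mull.
apply: eq_tsum => x y.
by rewrite legs_tens; try homs; rewrite (alg_homM hg) !mulrA fg.
Qed.

End LegsProducts.

(** The relation [t Delta(c) = Delta^cop(c) t] in the leg calculus: swapping the
two maps on the right-hand side is what flips the coproduct. *)
Definition intertwines_cop (k : fieldType) (C : algType k)
    (Delta : C -> C ⊗ C) (t : C ⊗ C) :=
  forall c (M : algType k) (f g : C -> M),
    alg_hom f -> alg_hom g -> commuting f g ->
    legs f g t * legs f g (Delta c) = legs g f (Delta c) * legs f g t.

Lemma intertwines_copP (k : fieldType) (C : algType k)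
    (Delta : C -> C ⊗ C) (t : C ⊗ C) :
  (forall c,
     \tsum_(t1, t2 <- t) \tsum_(c1, c2 <- Delta c) (t1 * c1) ⊗ (t2 * c2) =
     \tsum_(t1, t2 <- t) \tsum_(c1, c2 <- Delta c) (c2 * t1) ⊗ (c1 * t2)) <->
  intertwines_cop Delta t.
Proof.
split=> [E c M f g hf hg fg|U c].
  by rewrite -legs_mul // E legs_flip_mul.
have := U c _ _ _ (inl_alg_hom _ _) (inr_alg_hom _ _) (@commuting_inlr _ _ _).
rewrite -legs_mul -?legs_flip_mul ?legs_inlr //; homs.
Qed.

(** * Leg forms of the identities with the twist *)

Section Twists.
Variables (k : fieldType) (A B : algType k).
Variable tau : (A ⊗ B)%type -> (B ⊗ A)%type.
Hypothesis tau_hom : alg_hom tau.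

(** The two halves of the algebra map [legs f g \o tau]: [tauA f g] and
[tauB f g] are its restrictions to [A ⊗ 1] and [1 ⊗ B].  They commute when
[tau] is multiplicative, and then can stand in for legs in any leg form. *)
Definition tauA (M : algType k) (f : B -> M) (g : A -> M) : A -> M :=
  legs f g \o (tau \o inl_t).
Definition tauB (M : algType k) (f : B -> M) (g : A -> M) : B -> M :=
  legs f g \o (tau \o inr_t).

Section Images.
Variables (M : algType k) (f : B -> M) (g : A -> M).
Hypotheses (hf : alg_hom f) (hg : alg_hom g) (fg : commuting f g).

Lemma tauA_hom : alg_hom (tauA f g).
Proof. by rewrite /tauA; homs. Qed.

Lemma tauB_hom : alg_hom (tauB f g).
Proof. by rewrite /tauB; homs. Qed.

Lemma tauAB_commuting : commuting (tauA f g) (tauB f g).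
Proof.
move=> a b; rewrite /tauA /tauB /=.
have ltau := legs_alg_hom hf hg fg.
by rewrite -!(alg_homM ltau) -!(alg_homM tau_hom) commuting_inlr.
Qed.

Lemma legs_tau a b : legs f g (tau (a ⊗ b)) = tauA f g a * tauB f g b.
Proof.
have ltau := legs_alg_hom hf hg fg.
rewrite /tauA /tauB /= -(alg_homM ltau) -(alg_homM tau_hom).
by rewrite mul_tens mulr1 mul1r.
Qed.

Lemma legs_tauAB t : legs (tauA f g) (tauB f g) t = legs f g (tau t).
Proof.
move: t; apply: tensor_ext.
- apply: legs_linear; apply: alg_hom_linear; first exact: tauA_hom.
  exact: tauB_hom.
- by move=> c x y; rewrite (alg_hom_linear tau_hom) legs_linear //; homs.
move=> a b; rewrite legs_tau legs_tens //.
  by apply: alg_hom_linear; apply: tauA_hom.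
by apply: alg_hom_linear; apply: tauB_hom.
Qed.

Lemma commuting_tauA (S : Type) (h : S -> M) :
  commuting f h -> commuting g h -> commuting (tauA f g) h.
Proof. by move=> fh gh; rewrite /tauA; homs. Qed.

Lemma commuting_tauB (S : Type) (h : S -> M) :
  commuting f h -> commuting g h -> commuting (tauB f g) h.
Proof. by move=> fh gh; rewrite /tauB; homs. Qed.

End Images.

(** Leg form of [(tau ⊗ id) (u13 v23) = v13 u23]. *)
Definition twists_left (C : algType k) (u : A ⊗ C) (v : B ⊗ C) :=
  forall (M : algType k) (f : B -> M) (g : A -> M) (h : C -> M),
    commuting_homs f g h ->
    legs (tauA f g) h u * legs (tauB f g) h v = legs f h v * legs g h u.

Lemma twists_leftP (C : algType k) (u : A ⊗ C) (v : B ⊗ C) :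
  \tsum_(v1, v2 <- v) \tsum_(u1, u2 <- u)
    \tsum_(v1t, u1t <- tau (u1 ⊗ v1)) v1t ⊗ u1t ⊗ (u2 * v2) =
  \tsum_(v1, v2 <- v) \tsum_(u1, u2 <- u) v1 ⊗ u1 ⊗ (v2 * u2) <->
  twists_left u v.
Proof.
have lhsE (M : algType k) (f : B -> M) (g : A -> M) (h : C -> M) :
    commuting_homs f g h ->
    legs f (legs g h) (\tsum_(v1, v2 <- v) \tsum_(u1, u2 <- u)
      \tsum_(v1t, u1t <- tau (u1 ⊗ v1)) v1t ⊗ u1t ⊗ (u2 * v2)) =
    legs (tauA f g) h u * legs (tauB f g) h v.
  move=> [[hf hg hh] [fg fh gh]]; rewrite exchange_tsum legs_tsum; try homs.
  rewrite [legs _ h u]legsE tsum_mulr; apply: eq_tsum => u1 u2.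
  rewrite legs_tsum; try homs; rewrite [legs _ h v]legsE tsum_mull.
  apply: eq_tsum => v1 v2; rewrite legs_tsum; try homs.
  rewrite -!mulrA (mulrA (h u2)) -(commuting_tauB fh gh) !mulrA -legs_tau //.
  rewrite [legs f g _]legsE !tsum_mulr; apply: eq_tsum => b a.
  by rewrite legs3_tens; try homs; rewrite (alg_homM hh) !mulrA.
have rhsE (M : algType k) (f : B -> M) (g : A -> M) (h : C -> M) :
    commuting_homs f g h ->
    legs f (legs g h) (\tsum_(v1, v2 <- v) \tsum_(u1, u2 <- u)
      v1 ⊗ u1 ⊗ (v2 * u2)) = legs f h v * legs g h u.
  move=> [[hf hg hh] [fg fh gh]]; rewrite legs_tsum; try homs.
  rewrite [legs f h _]legsE tsum_mulr; apply: eq_tsum => v1 v2.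
  rewrite legs_tsum; try homs; rewrite [legs g h _]legsE tsum_mull.
  apply: eq_tsum => u1 u2; rewrite legs3_tens; try homs.
  rewrite (alg_homM hh) -!mulrA; congr (_ * _).
  by rewrite !mulrA gh.
split=> [tE M f g h fgh|U]; first by rewrite -lhsE // -rhsE // tE.
have := U _ _ _ _ (embeddings_commuting B A C).
by rewrite -lhsE -?rhsE ?legs3_embeddings //; apply: embeddings_commuting.
Qed.

(** Leg form of [(id ⊗ tau) (v13 u12) = u13 v12]. *)
Definition twists_right (C : algType k) (v : C ⊗ B) (u : C ⊗ A) :=
  forall (M : algType k) (h : C -> M) (f : B -> M) (g : A -> M),
    commuting_homs h f g ->
    legs h (tauB f g) v * legs h (tauA f g) u = legs h g u * legs h f v.

Lemma twists_rightP (C : algType k) (v : C ⊗ B) (u : C ⊗ A) :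
  \tsum_(v1, v2 <- v) \tsum_(u1, u2 <- u)
    \tsum_(v2t, u2t <- tau (u2 ⊗ v2)) (v1 * u1) ⊗ v2t ⊗ u2t =
  \tsum_(v1, v2 <- v) \tsum_(u1, u2 <- u) (u1 * v1) ⊗ v2 ⊗ u2 <->
  twists_right v u.
Proof.
have lhsE (M : algType k) (h : C -> M) (f : B -> M) (g : A -> M) :
    commuting_homs h f g ->
    legs h (legs f g) (\tsum_(v1, v2 <- v) \tsum_(u1, u2 <- u)
      \tsum_(v2t, u2t <- tau (u2 ⊗ v2)) (v1 * u1) ⊗ v2t ⊗ u2t) =
    legs h (tauB f g) v * legs h (tauA f g) u.
  move=> [[hh hf hg] [hhf hhg fg]]; rewrite legs_tsum; try homs.
  rewrite [legs h _ v]legsE tsum_mulr; apply: eq_tsum => v1 v2.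
  rewrite legs_tsum; try homs; rewrite [legs h _ u]legsE tsum_mull.
  apply: eq_tsum => u1 u2; rewrite legs_tsum; try homs.
  rewrite -!mulrA (mulrA (tauB f g v2)) commuting_tauB; try homs.
  rewrite -!mulrA -tauAB_commuting // -legs_tau // [legs f g _]legsE !tsum_mull.
  apply: eq_tsum => b a.
  by rewrite legs3_tens; try homs; rewrite (alg_homM hh) !mulrA.
have rhsE (M : algType k) (h : C -> M) (f : B -> M) (g : A -> M) :
    commuting_homs h f g ->
    legs h (legs f g) (\tsum_(v1, v2 <- v) \tsum_(u1, u2 <- u)
      (u1 * v1) ⊗ v2 ⊗ u2) = legs h g u * legs h f v.
  move=> [[hh hf hg] [hhf hhg fg]]; rewrite exchange_tsum legs_tsum; try homs.
  rewrite [legs h g _]legsE tsum_mulr; apply: eq_tsum => u1 u2.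
  rewrite legs_tsum; try homs; rewrite [legs h f _]legsE tsum_mull.
  apply: eq_tsum => v1 v2; rewrite legs3_tens; try homs.
  rewrite (alg_homM hh) -!mulrA; congr (_ * _).
  by rewrite fg !mulrA hhg.
split=> [tE M h f g fgh|U]; first by rewrite -lhsE // -rhsE // tE.
have := U _ _ _ _ (embeddings_commuting C B A).
by rewrite -lhsE -?rhsE ?legs3_embeddings //; apply: embeddings_commuting.
Qed.

(** [X] carries an element [x] of [A ⊗ B] to the flip of [tau x], and [Y] carries
[tau x] to the flip of [x].  As [tau] is multiplicative it is enough to say so
for [x] in [A ⊗ 1] and in [1 ⊗ B]. *)
Definition slides_A (X : A ⊗ B) :=
  forall (M : algType k) (f : A -> M) (g : B -> M),
  alg_hom f -> alg_hom g -> commuting f g ->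
  forall a, legs f g X * f a = tauA g f a * legs f g X.
Definition slides_B (X : A ⊗ B) :=
  forall (M : algType k) (f : A -> M) (g : B -> M),
  alg_hom f -> alg_hom g -> commuting f g ->
  forall b, legs f g X * g b = tauB g f b * legs f g X.
Definition unslides_A (Y : B ⊗ A) :=
  forall (M : algType k) (f : B -> M) (g : A -> M),
  alg_hom f -> alg_hom g -> commuting f g ->
  forall a, legs f g Y * tauA f g a = g a * legs f g Y.
Definition unslides_B (Y : B ⊗ A) :=
  forall (M : algType k) (f : B -> M) (g : A -> M),
  alg_hom f -> alg_hom g -> commuting f g ->
  forall b, legs f g Y * tauB f g b = f b * legs f g Y.

Lemma slides_AP (X : A ⊗ B) :
  (forall a, \tsum_(x1, x2 <- X) (x1 * a) ⊗ x2 =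
    \tsum_(x1, x2 <- X) \tsum_(onet, at_ <- tau (a ⊗ 1))
      (at_ * x1) ⊗ (onet * x2)) <->
  slides_A X.
Proof.
split=> [E M f g hf hg fg a|U a].
  by rewrite -legs_mulrl // E legs_flip_mul.
have := U _ _ _ (inl_alg_hom _ _) (inr_alg_hom _ _) (@commuting_inlr _ _ _) a.
rewrite -legs_mulrl -?legs_flip_mul ?legs_inlr //; homs.
Qed.

Lemma slides_BP (X : A ⊗ B) :
  (forall b, \tsum_(x1, x2 <- X) x1 ⊗ (x2 * b) =
    \tsum_(x1, x2 <- X) \tsum_(bt, onet <- tau (1 ⊗ b))
      (onet * x1) ⊗ (bt * x2)) <->
  slides_B X.
Proof.
split=> [E M f g hf hg fg a|U a].
  by rewrite -legs_mulr // E legs_flip_mul.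
have := U _ _ _ (inl_alg_hom _ _) (inr_alg_hom _ _) (@commuting_inlr _ _ _) a.
rewrite -legs_mulr -?legs_flip_mul ?legs_inlr //; homs.
Qed.

Lemma unslides_AP (Y : B ⊗ A) :
  (forall a, \tsum_(y1, y2 <- Y) \tsum_(onet, at_ <- tau (a ⊗ 1))
      (y1 * onet) ⊗ (y2 * at_) = \tsum_(y1, y2 <- Y) y1 ⊗ (a * y2)) <->
  unslides_A Y.
Proof.
split=> [E M f g hf hg fg a|U a].
  by rewrite -legs_mullr // -E legs_mul.
have := U _ _ _ (inl_alg_hom _ _) (inr_alg_hom _ _) (@commuting_inlr _ _ _) a.
rewrite -legs_mullr -?legs_mul ?legs_inlr //; homs.
Qed.

Lemma unslides_BP (Y : B ⊗ A) :
  (forall b, \tsum_(y1, y2 <- Y) \tsum_(bt, onet <- tau (1 ⊗ b))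
      (y1 * bt) ⊗ (y2 * onet) = \tsum_(y1, y2 <- Y) (b * y1) ⊗ y2) <->
  unslides_B Y.
Proof.
split=> [E M f g hf hg fg a|U a].
  by rewrite -legs_mull // -E legs_mul.
have := U _ _ _ (inl_alg_hom _ _) (inr_alg_hom _ _) (@commuting_inlr _ _ _) a.
rewrite -legs_mull -?legs_mul ?legs_inlr //; homs.
Qed.

Lemma slides_A_sum (X : A ⊗ B) (M : algType k) (f : A -> M) (g : B -> M) a :
  slides_A X -> alg_hom f -> alg_hom g -> commuting f g ->
  \tsum_(x1, x2 <- X) \tsum_(onet, at_ <- tau (a ⊗ 1))
     (f (at_ * x1) * g (onet * x2)) = legs f g X * f a.
Proof.
move=> /slides_AP E hf hg fg; rewrite -legs_mulrl // E legs_tsum; try homs.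
apply: eq_tsum => x1 x2; rewrite legs_tsum; try homs.
by apply: eq_tsum => b c; rewrite legs_tens; try homs.
Qed.

(** On the left-hand side [Z1] has been moved to the left of [X1] by means of
[tau]; undoing this with [slides_A] leaves [(id ⊗ tau) (X13 Z12) = Z13 X12]. *)
Lemma twists_right_slideP (Z : A ⊗ A) (X : A ⊗ B) : slides_A X ->
  \tsum_(z1, z2 <- Z) \tsum_(x1, x2 <- X)
      \tsum_(onet1, z1t1 <- tau (z1 ⊗ 1))
      \tsum_(bt2, z2t2 <- tau (z2 ⊗ (onet1 * x2)))
        (z1t1 * x1) ⊗ bt2 ⊗ z2t2 =
    \tsum_(z1, z2 <- Z) \tsum_(x1, x2 <- X) (z1 * x1) ⊗ x2 ⊗ z2 <->
  twists_right X Z.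
Proof.
move=> slX.
have lhsE (M : algType k) (h : A -> M) (f : B -> M) (g : A -> M) :
    commuting_homs h f g ->
    legs h (legs f g) (\tsum_(z1, z2 <- Z) \tsum_(x1, x2 <- X)
      \tsum_(onet1, z1t1 <- tau (z1 ⊗ 1))
      \tsum_(bt2, z2t2 <- tau (z2 ⊗ (onet1 * x2)))
        (z1t1 * x1) ⊗ bt2 ⊗ z2t2) =
    legs h (tauB f g) X * legs h (tauA f g) Z.
  move=> [[hh hf hg] [hhf hhg fg]]; rewrite legs_tsum; try homs.
  have hB := tauB_hom hf hg fg.
  have hhB : commuting h (tauB f g).
    by apply/commuting_sym/commuting_tauB; apply: commuting_sym.
  rewrite [legs h _ Z]legsE tsum_mull; apply: eq_tsum => z1 z2.
  rewrite mulrA -slides_A_sum // tsum_mulr legs_tsum; try homs.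
  apply: eq_tsum => x1 x2; rewrite tsum_mulr legs_tsum; try homs.
  apply: eq_tsum => o a; rewrite legs_tsum; try homs.
  rewrite -mulrA -tauAB_commuting // -legs_tau // [legs f g _]legsE tsum_mull.
  by apply: eq_tsum => b c; rewrite legs3_tens; try homs; rewrite mulrA.
have rhsE (M : algType k) (h : A -> M) (f : B -> M) (g : A -> M) :
    commuting_homs h f g ->
    legs h (legs f g) (\tsum_(z1, z2 <- Z) \tsum_(x1, x2 <- X)
      (z1 * x1) ⊗ x2 ⊗ z2) = legs h g Z * legs h f X.
  move=> [[hh hf hg] [hhf hhg fg]]; rewrite legs_tsum; try homs.
  rewrite [legs h g _]legsE tsum_mulr; apply: eq_tsum => u1 u2.
  rewrite legs_tsum; try homs; rewrite [legs h f _]legsE tsum_mull.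
  apply: eq_tsum => v1 v2; rewrite legs3_tens; try homs.
  rewrite (alg_homM hh) -!mulrA; congr (_ * _).
  by rewrite fg !mulrA hhg.
split=> [tE M h f g fgh|U]; first by rewrite -lhsE // -rhsE // tE.
have := U _ _ _ _ (embeddings_commuting A B A).
by rewrite -lhsE -?rhsE ?legs3_embeddings //; apply: embeddings_commuting.
Qed.

Section FourLegs.
Variables (W : B ⊗ B) (X : A ⊗ B) (Y : B ⊗ A) (Z : A ⊗ A).
Variables (M : algType k) (fA gA : A -> M) (fB gB : B -> M).

(** The element [X14 Z13 W24 Y23], where [fA], [fB], [gA], [gB] place the legs 1,
2, 3, 4. *)
Definition four_legs : M :=
  legs fA gB X * legs fA gA Z * legs fB gB W * legs fB gA Y.

End FourLegs.

End Twists.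

(** * Trivial legs and the smash coproduct *)

(** The composition of [eps] with the unit of [M].  It commutes with every map to
[M], so a leg sent through it can be ignored, and the counit axiom removes it
from a coproduct. *)
Definition triv (k : fieldType) (V : lmodType k) (M : algType k)
    (eps : V -> k) (v : V) : M := eps v *: 1.

Section Triv.
Variables (k : fieldType) (M : algType k).

Lemma triv_linear (V : lmodType k) (eps : V -> k) :
  scalar eps -> linear (triv M eps).
Proof. by move=> leps c x y; rewrite /triv leps scalerDl scalerA. Qed.

Lemma triv_alg_hom (C : algType k) (eps : C -> k) :
  scalar eps -> multiplicative_counit *%R 1 eps -> alg_hom (triv M eps).
Proof.
move=> leps [epsM eps1]; split; first exact: triv_linear.
split=> [|x y]; first by rewrite /triv eps1 scale1r.
by rewrite /triv epsM -scalerA -scalerAl mul1r.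
Qed.

Lemma mul_triv (V : lmodType k) (eps : V -> k) v (x : M) :
  triv M eps v * x = eps v *: x.
Proof. by rewrite /triv -scalerAl mul1r. Qed.

Lemma mul_trivr (V : lmodType k) (eps : V -> k) v (x : M) :
  x * triv M eps v = eps v *: x.
Proof. by rewrite /triv -scalerAr mulr1. Qed.

Lemma commuting_triv (V : lmodType k) (S : Type) (eps : V -> k) (f : S -> M) :
  commuting (triv M eps) f.
Proof. by move=> v x; rewrite mul_triv mul_trivr. Qed.

Variables (V : lmodType k) (Delta : V -> V ⊗ V) (eps : V -> k).
Hypothesis counits : counitary Delta eps.

Lemma legs_counitl (f : V -> M) v :
  linear f -> legs (triv M eps) f (Delta v) = f v.
Proof.
move=> lf; rewrite -[in RHS](counits v).1 linear_tsumE //.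
apply: eq_tsum => x y.
by rewrite mul_triv (linear_funZ lf).
Qed.

Lemma legs_counitr (f : V -> M) v :
  linear f -> legs f (triv M eps) (Delta v) = f v.
Proof.
move=> lf; rewrite -[in RHS](counits v).2 linear_tsumE //.
apply: eq_tsum => x y.
by rewrite mul_trivr (linear_funZ lf).
Qed.

End Triv.

Lemma legs_trivl (k : fieldType) (V W : lmodType k) (M : algType k)
    (eps : V -> k) (f : W -> M) (t : V ⊗ W) :
  legs (triv M eps) f t = \tsum_(v, w <- t) eps v *: f w.
Proof. by apply: eq_tsum => v w; rewrite mul_triv. Qed.

Lemma legs_trivr (k : fieldType) (V W : lmodType k) (M : algType k)
    (eps : W -> k) (f : V -> M) (t : V ⊗ W) :
  legs f (triv M eps) t = \tsum_(v, w <- t) eps w *: f v.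
Proof. by apply: eq_tsum => v w; rewrite mul_trivr. Qed.

Section SmashComul.
Variables (k : fieldType) (A B : algType k).
Variables (DeltaA : A -> A ⊗ A) (epsA : A -> k).
Variables (DeltaB : B -> B ⊗ B) (epsB : B -> k).
Variable tau : {linear (A ⊗ B)%type -> (B ⊗ A)%type}.
Local Notation H := (A ⊗ B)%type.
Local Notation Delta := (smash_comul DeltaA DeltaB tau).
Local Notation eps := (smash_counit epsA epsB).

Hypotheses (lDA : linear DeltaA) (lDB : linear DeltaB).
Hypotheses (leA : scalar epsA) (leB : scalar epsB).
Hypotheses (coA : counitary DeltaA epsA) (coB : counitary DeltaB epsB).
Hypotheses (coH : counitary Delta eps) (lD : linear Delta).

Definition projA : H -> A := legs id (triv A epsB).
Definition projB : H -> B := legs (triv B epsA) id.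

Section IntoM.
Variable M : algType k.
Local Notation oA := (triv M epsA).
Local Notation oB := (triv M epsB).

Let loA : linear oA. Proof. exact: triv_linear. Qed.
Let loB : linear oB. Proof. exact: triv_linear. Qed.

Lemma triv_smash_counit : triv M eps =1 legs oA oB.
Proof.
move=> x; rewrite /triv /smash_counit /legs /tsum scaler_suml.
by apply: eq_bigr => p _; rewrite -scalerAl mul1r scalerA.
Qed.

Lemma legs_smash_comul (f1 f3 : A -> M) (f2 f4 : B -> M) a b :
  linear f1 -> linear f2 -> linear f3 -> linear f4 ->
  legs (legs f1 f2) (legs f3 f4) (Delta (a ⊗ b)) =
  \tsum_(a1, a2 <- DeltaA a) f1 a1 *
    \tsum_(b1, b2 <- DeltaB b) legs f2 f3 (tau (a2 ⊗ b1)) * f4 b2.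
Proof.
move=> l1 l2 l3 l4; rewrite smash_comul_tens // legs_tsum; try homs.
apply: eq_tsum => a1 a2; rewrite legs_tsum; try homs; rewrite tsum_mull.
apply: eq_tsum => b1 b2; rewrite legs_tsum; try homs.
rewrite [legs f2 f3 _]legsE tsum_mulr tsum_mull; apply: eq_tsum => b' a'.
by rewrite !legs_tens; try homs; rewrite !mulrA.
Qed.

Let tau_linl (f : B -> M) (g : A -> M) b : linear f -> linear g ->
  linear (fun a => legs f g (tau (a ⊗ b))).
Proof.
move=> lf lg c x y; rewrite linearDl linearZl_LR linearP.
exact: legs_linear.
Qed.

Let tau_linr (f : B -> M) (g : A -> M) a : linear f -> linear g ->
  linear (fun b => legs f g (tau (a ⊗ b))).
Proof.
move=> lf lg c x y; rewrite linearDr linearZr_LR linearP.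
exact: legs_linear.
Qed.

Let inner_lin (f2 : B -> M) (f3 : A -> M) (f4 : B -> M) b :
  linear f2 -> linear f3 ->
  linear (fun a =>
    \tsum_(b1, b2 <- DeltaB b) legs f2 f3 (tau (a ⊗ b1)) * f4 b2).
Proof.
move=> l2 l3; apply: linear_tsum => b1 b2 c x y.
by rewrite tau_linl // mulrDl scalerAl.
Qed.

(** Counits on the two outer legs of a coproduct leave [tau] alone in the
middle. *)
Lemma legs_comul_outer (f : B -> M) (g : A -> M) a b : linear f -> linear g ->
  legs (legs oA f) (legs g oB) (Delta (a ⊗ b)) = legs f g (tau (a ⊗ b)).
Proof.
move=> lf lg; rewrite legs_smash_comul //.
apply: etrans (legs_counitl coA a (inner_lin oB b lf lg)) _.
exact (legs_counitr coB b (tau_linr a lf lg)).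
Qed.

(** [tau] is compatible with the counits of [A] and [B] because, by
[legs_comul_outer], this is the counit axiom of the smash coproduct with one more
leg sent to the scalars. *)
Lemma legs_tau_counitl (g : A -> M) a b : linear g ->
  legs oB g (tau (a ⊗ b)) = epsB b *: g a.
Proof.
move=> lg; have := legs_counitl coH (a ⊗ b) (legs_linear lg loB).
rewrite (eq_legs _ triv_smash_counit (fun _ => erefl)) legs_comul_outer //.
by rewrite legs_tens // mul_trivr.
Qed.

Lemma legs_tau_counitr (f : B -> M) a b : linear f ->
  legs f oA (tau (a ⊗ b)) = epsA a *: f b.
Proof.
move=> lf; have := legs_counitr coH (a ⊗ b) (legs_linear loA lf).
rewrite (eq_legs _ (fun _ => erefl) triv_smash_counit) legs_comul_outer //.
by rewrite legs_tens // mul_triv.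
Qed.

Lemma comp_projA (f : A -> M) : linear f -> f \o projA =1 legs f oB.
Proof.
move=> lf x; rewrite /= /projA !legs_trivr linear_tsumE //.
by apply: eq_tsum => a b; rewrite (linear_funZ lf).
Qed.

Lemma comp_projB (f : B -> M) : linear f -> f \o projB =1 legs oA f.
Proof.
move=> lf x; rewrite /= /projB !legs_trivl linear_tsumE //.
by apply: eq_tsum => a b; rewrite (linear_funZ lf).
Qed.

Let lp : linear projA.
Proof. by apply: legs_linear => //; apply: triv_linear. Qed.
Let lq : linear projB.
Proof. by apply: legs_linear => //; apply: triv_linear. Qed.

(** The four compositions of the coproduct with [projA] and [projB] are the
identity, [tau], [DeltaA \o projA] and [DeltaB \o projB]. *)
Lemma legs_comul_projAB (f : A -> M) (g : B -> M) h : linear f -> linear g ->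
  legs (f \o projA) (g \o projB) (Delta h) = legs f g h.
Proof.
move=> lf lg; rewrite (eq_legs _ (comp_projA lf) (comp_projB lg)).
move: h; apply: tensor_ext.
- by move=> c x y; rewrite lD legs_linear //; apply: legs_linear.
- exact: legs_linear.
move=> a b; rewrite legs_smash_comul // legs_tens //.
rewrite -[in RHS](legs_counitr coA a lf) [legs f oA _]legsE tsum_mulr.
apply: eq_tsum => a1 a2; rewrite -mulrA; congr (_ * _).
rewrite mul_triv -[in RHS](legs_counitl coB b lg) [legs oB g _]legsE.
rewrite /tsum scaler_sumr.
apply: eq_bigr => p _; rewrite legs_tau_counitl // mul_triv.
by rewrite -scalerAl mul_triv !scalerA mulrC.
Qed.

Lemma legs_comul_projBA (f : B -> M) (g : A -> M) h : linear f -> linear g ->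
  legs (f \o projB) (g \o projA) (Delta h) = legs f g (tau h).
Proof.
move=> lf lg; rewrite (eq_legs _ (comp_projB lf) (comp_projA lg)).
move: h; apply: tensor_ext.
- by move=> c x y; rewrite lD legs_linear //; apply: legs_linear.
- by move=> c x y; rewrite linearP legs_linear.
by move=> a b; rewrite legs_comul_outer.
Qed.

Lemma legs_comul_projAA (f g : A -> M) h : linear f -> linear g ->
  legs (f \o projA) (g \o projA) (Delta h) = legs f g (DeltaA (projA h)).
Proof.
move=> lf lg; rewrite (eq_legs _ (comp_projA lf) (comp_projA lg)).
move: h; apply: tensor_ext.
- by move=> c x y; rewrite lD legs_linear //; apply: legs_linear.
- by move=> c x y; rewrite lp lDA legs_linear.
move=> a b; rewrite legs_smash_comul // /projA legs_tens //; last first.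
  exact: triv_linear.
rewrite mul_trivr (linear_funZ lDA) (linear_funZ (legs_linear lf lg)).
rewrite legsE /tsum scaler_sumr; apply: eq_bigr => p _.
rewrite scalerAr; congr (_ * _).
apply: etrans (legs_counitr coB b (tau_linr p.2 loB lg)) _.
exact: legs_tau_counitl.
Qed.

Lemma legs_comul_projBB (f g : B -> M) h : linear f -> linear g ->
  legs (f \o projB) (g \o projB) (Delta h) = legs f g (DeltaB (projB h)).
Proof.
move=> lf lg; rewrite (eq_legs _ (comp_projB lf) (comp_projB lg)).
move: h; apply: tensor_ext.
- by move=> c x y; rewrite lD legs_linear //; apply: legs_linear.
- by move=> c x y; rewrite lq lDB legs_linear.
move=> a b; rewrite legs_smash_comul // /projB legs_tens //; last first.
  exact: triv_linear.
rewrite mul_triv (linear_funZ lDB) (linear_funZ (legs_linear lf lg)).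
apply: etrans (legs_counitl coA a (inner_lin g b lf loA)) _.
rewrite legsE /tsum scaler_sumr; apply: eq_bigr => p _.
rewrite legs_tau_counitr //.
by rewrite scalerAl.
Qed.

End IntoM.
End SmashComul.

(** * Quasitriangular structures and their images *)

Section QTLegs.
Variables (k : fieldType) (H : algType k) (Delta : H -> H ⊗ H) (eps : H -> k).
Variable R : H ⊗ H.

Lemma R13_R23E : tmul3 *%R (R13 1 R) (R23 1 R) =
  \tsum_(r1, r2 <- R) \tsum_(r1', r2' <- R) r1 ⊗ r1' ⊗ (r2 * r2').
Proof.
rewrite -[LHS]/(R13 1 R * R23 1 R) tsum_mulr; apply: eq_tsum => r1 r2.
rewrite tsum_mull; apply: eq_tsum => r1' r2'.
by rewrite !mul_tens mulr1 !mul1r.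
Qed.

Lemma R13_R12E : tmul3 *%R (R13 1 R) (R12 1 R) =
  \tsum_(r1, r2 <- R) \tsum_(r1', r2' <- R) (r1 * r1') ⊗ r2' ⊗ r2.
Proof.
rewrite -[LHS]/(R13 1 R * R12 1 R) tsum_mulr; apply: eq_tsum => r1 r2.
rewrite tsum_mull; apply: eq_tsum => r1' r2'.
by rewrite !mul_tens mulr1 !mul1r.
Qed.

Lemma Delta_cop_mulE h : tmul2 *%R (Delta_cop Delta h) R =
  \tsum_(r1, r2 <- R) \tsum_(h1, h2 <- Delta h) (h2 * r1) ⊗ (h1 * r2).
Proof.
rewrite -[LHS]/(Delta_cop Delta h * R) exchange_tsum tsum_mulr.
apply: eq_tsum => h1 h2; rewrite {1}[R]tensE tsum_mull; apply: eq_tsum => r1 r2.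
by rewrite mul_tens.
Qed.

Lemma quasitriangularP :
  quasitriangular *%R 1 Delta eps R <->
  [/\ legs (triv H eps) id R = 1 /\ legs id (triv H eps) R = 1,
      splits_left Delta R, splits_right Delta R & intertwines_cop Delta R].
Proof.
split=> [[QT1 QT2 QT3 QT4]|[QT1 QT2 QT3 QT4]]; split.
- by rewrite legs_trivl legs_trivr.
- by apply/splits_leftP; rewrite QT2 R13_R23E.
- by apply/splits_rightP; rewrite QT3 R13_R12E.
- by apply/intertwines_copP => h; rewrite -Delta_cop_mulE -QT4.
- by move: QT1; rewrite legs_trivl legs_trivr.
- by rewrite R13_R23E; apply/splits_leftP.
- by rewrite R13_R12E; apply/splits_rightP.
- move=> h; rewrite Delta_cop_mulE.
  exact (proj2 (intertwines_copP _ _) QT4 h).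
Qed.

End QTLegs.

Definition tensor_map (k : fieldType) (V W V' W' : lmodType k)
    (u : V -> V') (v : W -> W') (t : V ⊗ W) : V' ⊗ W' :=
  \tsum_(x, y <- t) u x ⊗ v y.

Section Images.
Variables (k : fieldType) (H : algType k) (R : H ⊗ H).

Lemma legs_image (C D M : algType k) (u : H -> C) (v : H -> D)
    (f : C -> M) (g : D -> M) :
  linear f -> linear g ->
  legs f g (tensor_map u v R) = legs (f \o u) (g \o v) R.
Proof.
by move=> lf lg; rewrite legs_tsum //; apply: eq_tsum => x y; rewrite legs_tens.
Qed.

Variable Delta : H -> H ⊗ H.

Lemma splits_left_image (C D : algType k) (u : H -> C) (v : H -> D)
    (DeltaC : C -> C ⊗ C) :
  alg_hom u -> alg_hom v -> linear DeltaC ->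
  (forall (M : algType k) (f g : C -> M) h, linear f -> linear g ->
     legs (f \o u) (g \o u) (Delta h) = legs f g (DeltaC (u h))) ->
  splits_left Delta R -> splits_left DeltaC (tensor_map u v R).
Proof.
move=> hu hv lD uD QT M f g h [[hf hg hh] [fg fh gh]].
rewrite !legs_image; try homs.
rewrite -QT; last by split; split; homs.
apply: eq_legs => // x; rewrite /= uD //; homs.
Qed.

Lemma splits_right_image (C D : algType k) (u : H -> C) (v : H -> D)
    (DeltaD : D -> D ⊗ D) :
  alg_hom u -> alg_hom v -> linear DeltaD ->
  (forall (M : algType k) (f g : D -> M) h, linear f -> linear g ->
     legs (f \o v) (g \o v) (Delta h) = legs f g (DeltaD (v h))) ->
  splits_right Delta R -> splits_right DeltaD (tensor_map u v R).
Proof.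
move=> hu hv lD vD QT M f g h [[hf hg hh] [fg fh gh]].
rewrite !legs_image; try homs.
rewrite -QT; last by split; split; homs.
apply: eq_legs => // x; rewrite /= vD //; homs.
Qed.

Lemma intertwines_cop_image (C : algType k) (u : H -> C)
    (DeltaC : C -> C ⊗ C) :
  alg_hom u -> (forall c, exists h, u h = c) ->
  (forall (M : algType k) (f g : C -> M) h, linear f -> linear g ->
     legs (f \o u) (g \o u) (Delta h) = legs f g (DeltaC (u h))) ->
  intertwines_cop Delta R -> intertwines_cop DeltaC (tensor_map u u R).
Proof.
move=> hu u_surj uD QT c M f g hf hg fg; have [h <-] := u_surj c.
rewrite legs_image -?uD; try homs; apply: QT; homs.
Qed.

End Images.

(** In the rest of this part [p] and [q] are algebra maps through which the
coproduct determines both the identity and [tau], so that leg forms for [R]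
specialize to leg forms with [tauA] and [tauB]. *)
Section TwistImages.
Variables (k : fieldType) (A B : algType k).
Local Notation H := (A ⊗ B)%type.
Variables (Delta : H -> H ⊗ H) (tau : H -> (B ⊗ A)%type).
Variables (p : H -> A) (q : H -> B).
Hypotheses (tau_hom : alg_hom tau) (hp : alg_hom p) (hq : alg_hom q).
Hypothesis Delta_pq : forall (M : algType k) (f : A -> M) (g : B -> M) h,
  linear f -> linear g -> legs (f \o p) (g \o q) (Delta h) = legs f g h.
Hypothesis Delta_qp : forall (M : algType k) (f : B -> M) (g : A -> M) h,
  linear f -> linear g -> legs (f \o q) (g \o p) (Delta h) = legs f g (tau h).
Variable R : H ⊗ H.

(** Both sides are the splitting of [R] at different triples: at
[tauA f g \o p], [tauB f g \o q] on one side and at [f \o q], [g \o p] on the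
other.  The splittings have the same left-hand side because [(p ⊗ q) Delta] is
the identity, [(q ⊗ p) Delta] is [tau], and [tauA f g], [tauB f g] are the halves
of [legs f g \o tau]. *)
Lemma twists_left_image (C : algType k) (r : H -> C) : alg_hom r ->
  splits_left Delta R -> twists_left tau (tensor_map p r R) (tensor_map q r R).
Proof.
move=> hr QT M f g h [[hf hg hh] [fg fh gh]].
have hA := tauA_hom tau_hom hf hg fg; have hB := tauB_hom tau_hom hf hg fg.
have AB := tauAB_commuting tau_hom hf hg fg.
have Ah := commuting_tauA tau fh gh.
have Bh := commuting_tauB tau fh gh.
rewrite !legs_image; try homs.
rewrite -!QT; try by split; split; homs.
apply: eq_legs => // x; rewrite /= Delta_pq ?Delta_qp ?legs_tauAB //; homs.
Qed.

Lemma twists_right_image (C : algType k) (r : H -> C) : alg_hom r ->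
  splits_right Delta R ->
  twists_right tau (tensor_map r q R) (tensor_map r p R).
Proof.
move=> hr QT M h f g [[hh hf hg] [hhf hhg fg]].
have hA := tauA_hom tau_hom hf hg fg; have hB := tauB_hom tau_hom hf hg fg.
have AB := tauAB_commuting tau_hom hf hg fg.
have Ah := commuting_tauA tau (commuting_sym hhf) (commuting_sym hhg).
have Bh := commuting_tauB tau (commuting_sym hhf) (commuting_sym hhg).
rewrite !legs_image; try homs.
rewrite -!QT; try by split; split; homs.
apply: eq_legs => // x; rewrite /= Delta_pq ?Delta_qp ?legs_tauAB //; homs.
Qed.

Lemma slides_image : intertwines_cop Delta R ->
  slides_A tau (tensor_map p q R) /\ slides_B tau (tensor_map p q R).
Proof.
move=> QT.
have QTpq (M : algType k) (f : A -> M) (g : B -> M) h :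
    alg_hom f -> alg_hom g -> commuting f g ->
    legs f g (tensor_map p q R) * legs f g h =
    legs g f (tau h) * legs f g (tensor_map p q R).
  move=> hf hg fg; rewrite legs_image -?Delta_pq -?Delta_qp; try homs.
  by apply: QT; homs.
split=> M f g hf hg fg c; have := QTpq M f g _ hf hg fg.
  by move/(_ (inl_t c)); rewrite legs_tens ?(alg_hom1 hg) ?mulr1; try homs.
by move/(_ (inr_t c)); rewrite legs_tens ?(alg_hom1 hf) ?mul1r; try homs.
Qed.

Lemma unslides_image : intertwines_cop Delta R ->
  unslides_A tau (tensor_map q p R) /\ unslides_B tau (tensor_map q p R).
Proof.
move=> QT.
have QTqp (M : algType k) (f : B -> M) (g : A -> M) h :
    alg_hom f -> alg_hom g -> commuting f g ->
    legs f g (tensor_map q p R) * legs f g (tau h) =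
    legs g f h * legs f g (tensor_map q p R).
  move=> hf hg fg; rewrite legs_image -?Delta_pq -?Delta_qp; try homs.
  by apply: QT; homs.
split=> M f g hf hg fg c; have := QTqp M f g _ hf hg fg.
  move/(_ (inl_t c)).
  by rewrite [legs g f _]legs_tens ?(alg_hom1 hf) ?mulr1; try homs.
move/(_ (inr_t c)).
by rewrite [legs g f _]legs_tens ?(alg_hom1 hg) ?mul1r; try homs.
Qed.

(** [R = ((p ⊗ q) Delta ⊗ (p ⊗ q) Delta) R]: split the first leg with
[R13 R23], then the second with [R13 R12]. *)
Lemma four_legs_image (M : algType k) (f g : H -> M) :
  alg_hom f -> alg_hom g -> commuting f g ->
  splits_left Delta R -> splits_right Delta R ->
  legs f g R =
  four_legs (tensor_map q q R) (tensor_map p q R) (tensor_map q p R)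
    (tensor_map p p R) (f \o inl_t) (g \o inl_t) (f \o inr_t) (g \o inr_t).
Proof.
move=> hf hg fg QTl QTr; rewrite /four_legs !legs_image; try homs.
have split_hom (h : H -> M) : alg_hom h ->
    legs ((h \o inl_t) \o p) ((h \o inr_t) \o q) \o Delta =1 h.
  move=> hh x; rewrite /= Delta_pq; try homs.
  by rewrite -alg_hom_legs // legs_inlr.
rewrite -(eq_legs _ (split_hom _ hf) (fun _ => erefl)) QTl; last first.
  by split; split; homs.
rewrite -!mulrA -QTr; last by split; split; homs.
rewrite mulrA -QTr; last by split; split; homs.
by congr (_ * _); apply: eq_legs => // x; rewrite split_hom.
Qed.

End TwistImages.

(** * Reassembling the components *)

Section Shuffles.
Variable M : pzRingType.

Lemma mulr_swap (x y z : M) : y * z = z * y -> x * y * z = x * z * y.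
Proof. by rewrite -!mulrA => ->. Qed.

(** The order of the eight factors after the coproduct has been applied to the
first leg; [xt], [zt] and [ws], [ys] are the ones which [tau] has twisted. *)
Lemma shuffle_left (x1 xt z1 zt ws w2 ys y2 w1 x2 y1 z2 : M) :
  xt * ws = w1 * x2 -> zt * ys = y1 * z2 ->
  z1 * ws = ws * z1 -> zt * ws = ws * zt -> zt * w2 = w2 * zt ->
  xt * z1 = z1 * xt -> y1 * w2 = w2 * y1 -> x2 * y1 = y1 * x2 ->
  w2 * z2 = z2 * w2 ->
  x1 * xt * (z1 * zt) * (ws * w2) * (ys * y2) =
  x1 * z1 * w1 * y1 * (x2 * z2 * w2 * y2).
Proof.
move=> xw zy c1 c2 c3 c4 c5 c6 c7; rewrite !mulrA.
rewrite (mulr_swap _ c4) (mulr_swap _ c2) (mulr_swap _ c3).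
rewrite -(mulrA _ xt ws) xw -(mulrA _ zt ys) zy !mulrA.
by rewrite -(mulr_swap _ c5) (mulr_swap _ c6) (mulr_swap _ c7).
Qed.

Lemma shuffle_right (x3 xs zt z2 w3 ws yt y2 z3 x2 y3 w2 : M) :
  xs * zt = z3 * x2 -> ws * yt = y3 * w2 ->
  z2 * w3 = w3 * z2 -> z2 * y3 = y3 * z2 -> x2 * w3 = w3 * x2 ->
  x2 * y3 = y3 * x2 ->
  x3 * xs * (zt * z2) * (w3 * ws) * (yt * y2) =
  x3 * z3 * w3 * y3 * (x2 * z2 * w2 * y2).
Proof.
move=> xz wy c1 c2 c3 c4; rewrite !mulrA.
rewrite -(mulrA _ xs zt) xz -(mulrA _ ws yt) wy !mulrA.
by rewrite (mulr_swap _ c1) (mulr_swap _ c2) (mulr_swap _ c3) (mulr_swap _ c4).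
Qed.

End Shuffles.

Lemma legs_conj (k : fieldType) (V W : lmodType k) (M : algType k)
    (f f' : V -> M) (g g' : W -> M) (y : M) t :
  (forall v, y * f v = f' v * y) -> (forall w, y * g w = g' w * y) ->
  y * legs f g t = legs f' g' t * y.
Proof.
move=> yf yg; rewrite tsum_mull tsum_mulr; apply: eq_tsum => v w.
by rewrite mulrA yf -!mulrA yg.
Qed.

Section Assembled.
Variables (k : fieldType) (A B : algType k).
Variables (W : B ⊗ B) (X : A ⊗ B) (Y : B ⊗ A) (Z : A ⊗ A).
Local Notation H := (A ⊗ B)%type.
Local Notation four_legs := (four_legs W X Y Z).

(** [X14 Z13 W24 Y23] in [H ⊗ H]. *)
Definition assembled : H ⊗ H :=
  four_legs (inl_t \o inl_t) (inr_t \o inl_t) (inl_t \o inr_t) (inr_t \o inr_t).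

Lemma eq_four_legs (M : algType k) (f f' g g' : A -> M) (u u' v v' : B -> M) :
  f =1 f' -> g =1 g' -> u =1 u' -> v =1 v' ->
  four_legs f g u v = four_legs f' g' u' v'.
Proof.
by move=> ff gg uu vv; rewrite /four_legs (eq_legs X ff vv) (eq_legs Z ff gg)
  (eq_legs W uu vv) (eq_legs Y uu gg).
Qed.

Lemma alg_hom_four_legs (M N : algType k) (h : M -> N)
    (f g : A -> M) (u v : B -> M) :
  alg_hom h ->
  h (four_legs f g u v) = four_legs (h \o f) (h \o g) (h \o u) (h \o v).
Proof.
by move=> hh; rewrite /four_legs !(alg_homM hh) !(alg_hom_legs _ _ _ hh).
Qed.

Lemma legs_assembled (M : algType k) (f g : H -> M) :
  alg_hom f -> alg_hom g -> commuting f g ->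
  legs f g assembled =
  four_legs (f \o inl_t) (g \o inl_t) (f \o inr_t) (g \o inr_t).
Proof.
move=> hf hg fg; have hfg := legs_alg_hom hf hg fg.
have fl x : legs f g (inl_t x) = f x.
  by rewrite legs_tens ?(alg_hom1 hg) ?mulr1; try homs.
have gr x : legs f g (inr_t x) = g x.
  by rewrite legs_tens ?(alg_hom1 hf) ?mul1r; try homs.
by rewrite /assembled alg_hom_four_legs //; apply: eq_four_legs => x /=.
Qed.

(** The sum is [alpha] with its four legs placed in [M]; [slides_A] undoes the
twist of [Z1] across [X] in it and leaves [X14 Z13]. *)
Lemma four_legs_tsum (tau : H -> (B ⊗ A)%type) (M : algType k)
    (fA gA : A -> M) (fB gB : B -> M) :
  alg_hom fA -> alg_hom gA -> alg_hom fB -> alg_hom gB ->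
  commuting fA gB -> commuting gA fB -> commuting gA gB -> commuting fB gB ->
  slides_A tau X ->
  \tsum_(z1, z2 <- Z) \tsum_(x1, x2 <- X)
  \tsum_(y1, y2 <- Y) \tsum_(w1, w2 <- W)
  \tsum_(onet, z1t <- tau (z1 ⊗ 1))
    fA (z1t * x1) * fB (w1 * y1) * (gA (z2 * y2) * gB (onet * x2 * w2)) =
  four_legs fA gA fB gB.
Proof.
move=> hfA hgA hfB hgB fAgB gAfB gAgB fBgB slX; rewrite /four_legs.
rewrite [legs _ _ Z]legsE tsum_mull !tsum_mulr; apply: eq_tsum => z1 z2.
rewrite [legs _ _ X * _]mulrA -(slides_A_sum _ slX) // !tsum_mulr.
apply: eq_tsum => x1 x2; rewrite -mulrA; set T := _ * gA z2.
rewrite [legs _ _ Y]legsE !tsum_mull.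
apply: eq_tsum => y1 y2; rewrite [legs _ _ W]legsE tsum_mulr tsum_mull.
apply: eq_tsum => w1 w2.
rewrite /T !tsum_mulr; apply: eq_tsum => o a.
rewrite (alg_homM hfB) (alg_homM hgA) (alg_homM hgB _ w2) !mulrA.
rewrite (mulr_swap _ (esym (fBgB y1 w2))) (mulr_swap _ (esym (gAgB y2 w2))).
rewrite (mulr_swap _ (gAfB z2 w1)) (mulr_swap _ (gAfB z2 y1)).
rewrite (mulr_swap _ (esym (fBgB w1 _))) (mulr_swap _ (esym (fBgB y1 _))).
by rewrite (mulr_swap _ (esym (gAgB z2 _))) (mulr_swap _ (esym (gAgB y2 _))).
Qed.

Lemma alphaE (tau : {linear H -> (B ⊗ A)%type}) : slides_A tau X ->
  alpha tau W X Y Z = assembled.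
Proof.
move=> slX; rewrite /assembled -(four_legs_tsum _ _ _ _ _ _ _ _ slX); try homs.
apply: eq_tsum => z1 z2; apply: eq_tsum => x1 x2; apply: eq_tsum => y1 y2.
apply: eq_tsum => w1 w2; apply: eq_tsum => o a /=.
by rewrite !mul_tens !mul1r !mulr1.
Qed.

End Assembled.

Section Backward.
Variables (k : fieldType) (A B : algType k).
Variables (DeltaA : A -> A ⊗ A) (DeltaB : B -> B ⊗ B).
Local Notation H := (A ⊗ B)%type.
Variables (Delta : H -> H ⊗ H) (tau : H -> (B ⊗ A)%type).
Hypotheses (Delta_hom : alg_hom Delta) (tau_hom : alg_hom tau).
Hypothesis Delta_inl : forall (M : algType k) (f g : H -> M) a,
  alg_hom f -> alg_hom g ->
  legs f g (Delta (inl_t a)) =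
  legs (f \o inl_t) (tauA tau (f \o inr_t) (g \o inl_t)) (DeltaA a).
Hypothesis Delta_inr : forall (M : algType k) (f g : H -> M) b,
  alg_hom f -> alg_hom g ->
  legs f g (Delta (inr_t b)) =
  legs (tauB tau (f \o inr_t) (g \o inl_t)) (g \o inr_t) (DeltaB b).

Variables (W : B ⊗ B) (X : A ⊗ B) (Y : B ⊗ A) (Z : A ⊗ A).

Ltac homs3 := by split; split; homs.

(** In the proof, [T] and [S] are the halves of [tau] on the two middle legs of
the coproduct: on [A ⊗ 1] the coproduct is [DeltaA] followed by [T] on its second
leg, on [1 ⊗ B] it is [DeltaB] followed by [S] on its first.  The factors
containing [T] and [S] meet in the pairs [X W] and [Z Y], to which the identities
with [tau] apply. *)
Lemma assembled_splits_left :
  splits_left DeltaA X -> splits_left DeltaA Z ->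
  splits_left DeltaB W -> splits_left DeltaB Y ->
  twists_left tau X W -> twists_left tau Z Y ->
  splits_left Delta (assembled W X Y Z).
Proof.
move=> sX sZ sW sY tXW tZY M f g h [[hf hg hh] [fg fh gh]].
have fi : alg_hom (f \o inr_t) by homs.
have gi : alg_hom (g \o inl_t) by homs.
have figi : commuting (f \o @inr_t k A B) (g \o inl_t) by homs.
set T := tauA tau (f \o inr_t) (g \o inl_t).
set S := tauB tau (f \o inr_t) (g \o inl_t).
have hT : alg_hom T by apply: tauA_hom.
have hS : alg_hom S by apply: tauB_hom.
have TS : commuting T S by apply: tauAB_commuting.
have Tc (V : Type) (u : V -> M) : commuting (f \o @inr_t k A B) u ->
  commuting (g \o @inl_t k A B) u -> commuting T u by apply: commuting_tauA.
have Sc (V : Type) (u : V -> M) : commuting (f \o @inr_t k A B) u ->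
  commuting (g \o @inl_t k A B) u -> commuting S u by apply: commuting_tauB.
have T1 : commuting T (f \o inl_t) by apply: Tc; homs.
have T2 : commuting T (g \o inr_t) by apply: Tc; homs.
have Th : commuting T h by apply: Tc; homs.
have S1 : commuting S (f \o inl_t) by apply: Sc; homs.
have S2 : commuting S (g \o inr_t) by apply: Sc; homs.
have Sh : commuting S h by apply: Sc; homs.
rewrite !legs_assembled; try homs; rewrite /four_legs.
have El : (legs f g \o Delta) \o inl_t =1 legs (f \o inl_t) T \o DeltaA.
  by move=> a; rewrite /= Delta_inl.
have Er : (legs f g \o Delta) \o inr_t =1 legs S (g \o inr_t) \o DeltaB.
  by move=> b; rewrite /= Delta_inr.
rewrite !(eq_legs _ El (fun _ => erefl)) !(eq_legs _ Er (fun _ => erefl)).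
rewrite sX; last homs3.
rewrite sZ; last homs3.
rewrite sW; last homs3.
rewrite sY; last homs3.
apply: shuffle_left; try by apply: commuting_legsl; homs.
- by apply: tXW; homs3.
- by apply: tZY; homs3.
Qed.

Lemma assembled_splits_right :
  splits_right DeltaB X -> splits_right DeltaA Z ->
  splits_right DeltaB W -> splits_right DeltaA Y ->
  twists_right tau X Z -> twists_right tau W Y ->
  splits_right Delta (assembled W X Y Z).
Proof.
move=> sX sZ sW sY tXZ tWY M f g h [[hf hg hh] [fg fh gh]].
have gi : alg_hom (g \o inr_t) by homs.
have hi : alg_hom (h \o inl_t) by homs.
have gihi : commuting (g \o @inr_t k A B) (h \o inl_t) by homs.
set T := tauA tau (g \o inr_t) (h \o inl_t).
set S := tauB tau (g \o inr_t) (h \o inl_t).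
have hT : alg_hom T by apply: tauA_hom.
have hS : alg_hom S by apply: tauB_hom.
have Tc (V : Type) (u : V -> M) : commuting (g \o @inr_t k A B) u ->
  commuting (h \o @inl_t k A B) u -> commuting T u by apply: commuting_tauA.
have Sc (V : Type) (u : V -> M) : commuting (g \o @inr_t k A B) u ->
  commuting (h \o @inl_t k A B) u -> commuting S u by apply: commuting_tauB.
have Tf : commuting T f by apply: Tc; homs.
have T2 : commuting T (g \o inl_t) by apply: Tc; homs.
have Sf : commuting S f by apply: Sc; homs.
have S3 : commuting S (h \o inr_t) by apply: Sc; homs.
rewrite !legs_assembled; try homs; rewrite /four_legs.
have El : (legs g h \o Delta) \o inl_t =1 legs (g \o inl_t) T \o DeltaA.
  by move=> a; rewrite /= Delta_inl.
have Er : (legs g h \o Delta) \o inr_t =1 legs S (h \o inr_t) \o DeltaB.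
  by move=> b; rewrite /= Delta_inr.
rewrite !(eq_legs _ (fun _ => erefl) El) !(eq_legs _ (fun _ => erefl) Er).
rewrite sX; last homs3.
rewrite sZ; last homs3.
rewrite sW; last homs3.
rewrite sY; last homs3.
apply: shuffle_right; try by apply: commuting_legsl; homs.
- by apply: tXZ; homs3.
- by apply: tWY; homs3.
Qed.

(** On the coproduct of an element of [A], the factor [Y] removes the twist, [Z]
flips the two legs coming from [DeltaA], [W] commutes with them, and [X]
introduces the twist of the opposite coproduct.  For an element of [B] the roles
of [Z] and [W] are exchanged. *)
Lemma assembled_intertwines_cop :
  intertwines_cop DeltaA Z -> intertwines_cop DeltaB W ->
  slides_A tau X -> slides_B tau X -> unslides_A tau Y -> unslides_B tau Y ->
  intertwines_cop Delta (assembled W X Y Z).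
Proof.
move=> iZ iW sXA sXB sYA sYB x M f g hf hg fg.
have hfg := legs_alg_hom hf hg fg.
have hgf := legs_alg_hom hg hf (commuting_sym fg).
have cW : commuting (legs (f \o @inr_t k A B) (g \o inr_t))
  (legs (f \o @inl_t k A B) (g \o inl_t)) by homs.
have cZ : commuting (legs (f \o @inl_t k A B) (g \o inl_t))
  (legs (g \o @inr_t k A B) (f \o inr_t)) by homs.
have cop_inl a : legs f g (assembled W X Y Z) * legs f g (Delta (inl_t a)) =
    legs g f (Delta (inl_t a)) * legs f g (assembled W X Y Z).
  rewrite legs_assembled // !Delta_inl // /four_legs -!mulrA.
  rewrite (legs_conj (f' := f \o inl_t) (g' := g \o inl_t)); first last.
  - by move=> v; apply: sYA; homs.
  - by move=> v; apply: commuting_legsl; homs.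
  rewrite (mulrA (legs _ _ W)) cW -!mulrA (mulrA (legs _ _ Z)) iZ; try homs.
  rewrite -!mulrA !(mulrA (legs _ _ X)) (legs_conj (f' := g \o inl_t)
    (g' := tauA tau (g \o inr_t) (f \o inl_t))) ?mulrA //.
    by move=> v; apply: commuting_legsl; homs.
  by move=> v; apply: sXA; homs.
have cop_inr b : legs f g (assembled W X Y Z) * legs f g (Delta (inr_t b)) =
    legs g f (Delta (inr_t b)) * legs f g (assembled W X Y Z).
  rewrite legs_assembled // !Delta_inr // /four_legs -!mulrA.
  rewrite (legs_conj (f' := f \o inr_t) (g' := g \o inr_t)); first last.
  - by move=> v; apply: commuting_legsl; homs.
  - by move=> v; apply: sYB; homs.
  rewrite (mulrA (legs _ _ W)) iW; try homs.
  rewrite -!mulrA (mulrA (legs _ _ Z)) cZ -!mulrA.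
  rewrite !(mulrA (legs _ _ X)) (legs_conj
    (f' := tauB tau (g \o inr_t) (f \o inl_t)) (g' := f \o inr_t)) ?mulrA //.
    by move=> v; apply: sXB; homs.
  by move=> v; apply: commuting_legsl; homs.
have lD := alg_hom_linear Delta_hom.
move: x; apply: tensor_ext => [c x y|c x y|a b].
- by rewrite lD legs_linear ?mulrDr -?scalerAr; try homs.
- by rewrite lD legs_linear ?mulrDl -?scalerAl; try homs.
have -> : a ⊗ b = inl_t a * inr_t b by rewrite mul_tens mul1r mulr1.
rewrite (alg_homM Delta_hom) (alg_homM hfg) (alg_homM hgf).
by rewrite mulrA cop_inl -!mulrA cop_inr.
Qed.

End Backward.

Section Counits.
Variables (k : fieldType) (A B : algType k) (epsA : A -> k) (epsB : B -> k).
Variable eps : (A ⊗ B)%type -> k.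
Local Notation H := (A ⊗ B)%type.
Hypothesis le : scalar eps.
Hypothesis eA : multiplicative_counit *%R 1 epsA.
Hypothesis eB : multiplicative_counit *%R 1 epsB.
Hypothesis e : multiplicative_counit *%R 1 eps.
Hypothesis epsE : forall a b, eps (a ⊗ b) = epsA a * epsB b.
Variables (W : B ⊗ B) (X : A ⊗ B) (Y : B ⊗ A) (Z : A ⊗ A).

Lemma normalizedE (C D : algType k) (epsC : C -> k) (epsD : D -> k)
    (t : C ⊗ D) :
  normalized epsC epsD t <->
  legs (triv D epsC) id t = 1 /\ legs id (triv C epsD) t = 1.
Proof. by rewrite legs_trivl legs_trivr. Qed.

Lemma legs_trivl1 (C D M : algType k) (epsC : C -> k) (f : D -> M) t :
  legs (triv D epsC) id t = 1 -> alg_hom f -> legs (triv M epsC) f t = 1.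
Proof.
rewrite !legs_trivl => t1 hf; rewrite -(alg_hom1 hf) -t1 linear_tsumE; try homs.
by apply: eq_tsum => c d; rewrite (linear_funZ (alg_hom_linear hf)).
Qed.

Lemma legs_trivr1 (C D M : algType k) (epsD : D -> k) (f : C -> M) t :
  legs id (triv C epsD) t = 1 -> alg_hom f -> legs f (triv M epsD) t = 1.
Proof.
rewrite !legs_trivr => t1 hf; rewrite -(alg_hom1 hf) -t1 linear_tsumE; try homs.
by apply: eq_tsum => c d; rewrite (linear_funZ (alg_hom_linear hf)).
Qed.

Lemma assembled_counits : normalized_components epsA epsB W X Y Z ->
  legs (triv H eps) id (assembled W X Y Z) = 1 /\
  legs id (triv H eps) (assembled W X Y Z) = 1.
Proof.
case=> /normalizedE[W1 W2] /normalizedE[X1 X2] /normalizedE[Y1 Y2].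
move=> /normalizedE[Z1 Z2].
have ht : alg_hom (triv H eps) by apply: triv_alg_hom.
have Tl : triv H eps \o inl_t =1 triv H epsA.
  by move=> a; rewrite /= /triv epsE eB.2 mulr1.
have Tr : triv H eps \o inr_t =1 triv H epsB.
  by move=> b; rewrite /= /triv epsE eA.2 mul1r.
have ct : commuting (triv H eps) (@id H) by apply: commuting_triv.
split; rewrite legs_assembled //; try exact: commuting_sym.
  rewrite (eq_four_legs _ _ _ _ Tl (fun _ => erefl) Tr (fun _ => erefl)).
  by rewrite /four_legs (legs_trivl1 W1) ?(legs_trivl1 X1) ?(legs_trivl1 Y1)
    ?(legs_trivl1 Z1) ?mulr1; try homs.
rewrite (eq_four_legs _ _ _ _ (fun _ => erefl) Tl (fun _ => erefl) Tr).
by rewrite /four_legs (legs_trivr1 W2) ?(legs_trivr1 X2) ?(legs_trivr1 Y2)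
  ?(legs_trivr1 Z2) ?mulr1; try homs.
Qed.

End Counits.

(** * Conormal smash biproducts *)

Section LegIdentities.
Variables (k : fieldType) (A B : algType k).
Variables (DeltaA : A -> A ⊗ A) (DeltaB : B -> B ⊗ B) (epsB : B -> k).
Variable tau : {linear (A ⊗ B)%type -> (B ⊗ A)%type}.
Variables (W : B ⊗ B) (X : A ⊗ B) (Y : B ⊗ A) (Z : A ⊗ A).

Record leg_identities : Prop := LegIdentities {
  leg_cop : intertwines_cop DeltaA Z /\ intertwines_cop DeltaB W;
  leg_slides : slides_A tau X /\ slides_B tau X;
  leg_unslides : unslides_A tau Y /\ unslides_B tau Y;
  leg_left : [/\ splits_left DeltaA Z, splits_left DeltaA X,
                 splits_left DeltaB Y & splits_left DeltaB W];
  leg_right : [/\ splits_right DeltaA Z, splits_right DeltaB X,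
                  splits_right DeltaA Y & splits_right DeltaB W];
  leg_twists_left : twists_left tau Z Y /\ twists_left tau X W;
  leg_twists_right : twists_right tau X Z /\ twists_right tau W Y
}.

Lemma component_identitiesP : alg_hom tau ->
  component_identities DeltaA DeltaB epsB tau W X Y Z <-> leg_identities.
Proof.
move=> tau_hom; split.
  case=> /intertwines_copP c1 /slides_AP c2 /unslides_AP c3 _ /slides_BP c5.
  move=> /unslides_BP c6 /intertwines_copP c7 /splits_leftP c8 /splits_leftP c9.
  move=> /(twists_leftP tau_hom) c10 /(twists_leftP tau_hom) c11.
  move=> /splits_leftP c12 /splits_leftP c13 /splits_rightP c14.
  move=> /(twists_right_slideP tau_hom _ c2) c15 /splits_rightP c16.
  move=> /splits_rightP c17 /(twists_rightP tau_hom) c18 /splits_rightP c19.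
  by split.
case=> [[c1 c7] [c2 c5] [c3 c6] [c8 c9 c12 c13] [c14 c16 c17 c19]].
move=> [c10 c11] [c15 c18].
split=> //; try exact/intertwines_copP; try exact/splits_leftP;
  try exact/splits_rightP.
- exact/slides_AP.
- exact/unslides_AP.
- exact/slides_BP.
- exact/unslides_BP.
- exact/(twists_leftP tau_hom).
- exact/(twists_leftP tau_hom).
- exact/(twists_right_slideP tau_hom _ c2).
- exact/(twists_rightP tau_hom).
Qed.

End LegIdentities.

Section Biproduct.
Variables (k : fieldType) (A B : algType k).
Variables (DeltaA : A -> A ⊗ A) (epsA : A -> k).
Variables (DeltaB : B -> B ⊗ B) (epsB : B -> k).
Variable sigma : {linear (B ⊗ A)%type -> (A ⊗ B)%type}.
Variable tau : {linear (A ⊗ B)%type -> (B ⊗ A)%type}.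
Hypothesis sbb : smash_biproduct_bialgebra DeltaA epsA DeltaB epsB sigma tau.
Hypothesis sigma_left : left_conormal epsB sigma.
Hypothesis sigma_right : right_conormal epsA sigma.
Local Notation H := (A ⊗ B)%type.
Local Notation Delta := (smash_comul DeltaA DeltaB tau).
Local Notation eps := (smash_counit epsA epsB).
Local Notation p := (@projA k A B epsB).
Local Notation q := (@projB k A B epsA).
Local Notation m := (smash_mul sigma).

Let lDA : linear DeltaA. Proof. by case: (sbb_coalgA sbb). Qed.
Let lDB : linear DeltaB. Proof. by case: (sbb_coalgB sbb). Qed.
Let leA : scalar epsA. Proof. by case: (sbb_coalgA sbb). Qed.
Let leB : scalar epsB. Proof. by case: (sbb_coalgB sbb). Qed.
Let coA : counitary DeltaA epsA. Proof. by case: (sbb_coalgA sbb). Qed.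
Let coB : counitary DeltaB epsB. Proof. by case: (sbb_coalgB sbb). Qed.
Let lD : linear Delta. Proof. by case: (sbb_coproduct sbb). Qed.
Let coH : counitary Delta eps. Proof. by case: (sbb_coproduct sbb). Qed.
Let leH : scalar eps. Proof. by case: (sbb_coproduct sbb). Qed.
Let eA := (sbb_counital sbb).1.
Let eB := (sbb_counital sbb).2.
Let hoA (M : algType k) : alg_hom (triv M epsA).
Proof. exact: triv_alg_hom. Qed.
Let hoB (M : algType k) : alg_hom (triv M epsB).
Proof. exact: triv_alg_hom. Qed.

Lemma projA_hom : alg_hom p.
Proof. by apply: legs_alg_hom => //; apply/commuting_sym/commuting_triv. Qed.

Lemma projB_hom : alg_hom q.
Proof. by apply: legs_alg_hom => //; apply: commuting_triv. Qed.

Let lp := alg_hom_linear projA_hom.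
Let lq := alg_hom_linear projB_hom.

Let ml x : linear (m x). Proof. by case: (sbb_product sbb). Qed.
Let mr y : linear (m^~ y). Proof. by case: (sbb_product sbb). Qed.

Lemma smash_mul_morph (C : algType k) (f : H -> C) : linear f ->
  (forall a b a' b', f (m (a ⊗ b) (a' ⊗ b')) = f (a ⊗ b) * f (a' ⊗ b')) ->
  forall x y, f (m x y) = f x * f y.
Proof.
move=> lf fm x y; move: x; apply: tensor_ext => [c u v|c u v|a b].
- by rewrite mr lf.
- by rewrite lf mulrDl scalerAl.
move: y; apply: tensor_ext => [c u v|c u v|a' b'] //.
- by rewrite ml lf.
- by rewrite lf mulrDr scalerAr.
Qed.

Lemma projA_smash_mul x y : p (m x y) = p x * p y.
Proof.
have hB := hoB A; move: x y; apply: smash_mul_morph => // a b a' b'.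
rewrite smash_mul_tens linear_tsumE // {2 3}/projA !legs_tens; try homs.
rewrite !mul_trivr /=.
transitivity
  (epsB b' *: (a * \tsum_(a_s, b_s <- sigma (b ⊗ a')) epsB b_s *: a_s)).
  rewrite tsum_mull /tsum scaler_sumr; apply: eq_bigr => r _.
  rewrite /projA legs_tens; try homs.
  by rewrite mul_trivr eB.1 -scalerAr scalerA mulrC.
by rewrite sigma_left -!scalerAr -!scalerAl scalerAr.
Qed.

Lemma projB_smash_mul x y : q (m x y) = q x * q y.
Proof.
have hA := hoA B; move: x y; apply: smash_mul_morph => // a b a' b'.
rewrite smash_mul_tens linear_tsumE // {2 3}/projB !legs_tens; try homs.
rewrite !mul_triv /=.
transitivity
  (epsA a *: ((\tsum_(a_s, b_s <- sigma (b ⊗ a')) epsA a_s *: b_s) * b')).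
  rewrite tsum_mulr /tsum scaler_sumr; apply: eq_bigr => r _.
  rewrite /projB legs_tens; try homs.
  by rewrite mul_triv eA.1 -scalerAl scalerA.
by rewrite sigma_right -!scalerAr -!scalerAl !scalerA mulrC.
Qed.

(** Since [(p ⊗ q) Delta] is the identity and [Delta], [p], [q] are
multiplicative for the smash product, the smash product is the one of the tensor
product algebra; equivalently [sigma] is the flip. *)
Lemma smash_mulE : m = *%R.
Proof.
have [_ _ DM _ _] := sbb_bialgebra sbb.
apply/funext => x; apply/funext => y.
have lI := alg_hom_linear (inl_alg_hom A B).
have lJ := alg_hom_linear (inr_alg_hom A B).
have pq := legs_comul_projAB lDA lDB leA leB coA coB coH lD _ lI lJ.
rewrite -[LHS]legs_inlr -pq DM legs_tmul; try homs.
- by rewrite !pq !legs_inlr.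
- by move=> u v; rewrite /= projA_smash_mul (alg_homM (inl_alg_hom _ _)).
- by move=> u v; rewrite /= projB_smash_mul (alg_homM (inr_alg_hom _ _)).
Qed.

Lemma smash_comul_hom : alg_hom Delta.
Proof.
have [_ _ DM D1 _] := sbb_bialgebra sbb.
by split=> //; split=> // x y; move: (DM x y); rewrite smash_mulE.
Qed.

(** [tau] is [(q ⊗ p) Delta], a composition of algebra maps. *)
Lemma tau_alg_hom : alg_hom tau.
Proof.
pose F := legs (inl_t \o q) (inr_t \o p) \o Delta.
have FE : F =1 tau.
  move=> x; rewrite /F /= legs_comul_projBA ?legs_inlr //; homs.
have hF : alg_hom F.
  have hp := projA_hom; have hq := projB_hom; have hD := smash_comul_hom.
  by rewrite /F; homs.
by rewrite -(funext FE).
Qed.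

Lemma smash_counit_mult : multiplicative_counit *%R 1 eps.
Proof. by have [_ _ _ _] := sbb_bialgebra sbb; rewrite smash_mulE. Qed.

Lemma smash_counit_tens a b : eps (a ⊗ b) = epsA a * epsB b.
Proof.
rewrite /smash_counit tsum_tens //; split=> [w|v] c x y /=.
  by rewrite leA mulrDl -mulrA.
by rewrite leB mulrDr mulrCA.
Qed.

(** As [DeltaB 1 = 1 ⊗ 1], only [DeltaA] and the restriction of [tau] to [A ⊗ 1]
are left of the smash coproduct on [A ⊗ 1]. *)
Lemma smash_comul_inl (M : algType k) (f g : H -> M) a :
  alg_hom f -> alg_hom g ->
  legs f g (Delta (inl_t a)) =
  legs (f \o inl_t) (tauA tau (f \o inr_t) (g \o inl_t)) (DeltaA a).
Proof.
move=> hf hg.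
have split_hom (h : H -> M) : alg_hom h -> h =1 legs (h \o inl_t) (h \o inr_t).
  by move=> hh x; rewrite -alg_hom_legs // legs_inlr.
rewrite (eq_legs _ (split_hom _ hf) (split_hom _ hg)).
rewrite legs_smash_comul; try homs.
apply: eq_tsum => a1 a2; congr (_ * _).
have [DB1 _] := (sbb_unital sbb).2.
have bil : bilinear_for *:%R *:%R (fun b1 b2 : B =>
    legs (f \o inr_t) (g \o inl_t) (tau (a2 ⊗ b1)) * (g \o inr_t) b2).
  apply: (legs_bilinear
    (f := fun b1 => legs (f \o inr_t) (g \o inl_t) (tau (a2 ⊗ b1)))).
    by move=> c x y; rewrite linearDr linearZr_LR linearP legs_linear //; homs.
  by homs.
by rewrite DB1 tsum_tens //= (alg_hom1 hg) mulr1.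
Qed.

Lemma smash_comul_inr (M : algType k) (f g : H -> M) b :
  alg_hom f -> alg_hom g ->
  legs f g (Delta (inr_t b)) =
  legs (tauB tau (f \o inr_t) (g \o inl_t)) (g \o inr_t) (DeltaB b).
Proof.
move=> hf hg.
have split_hom (h : H -> M) : alg_hom h -> h =1 legs (h \o inl_t) (h \o inr_t).
  by move=> hh x; rewrite -alg_hom_legs // legs_inlr.
rewrite (eq_legs _ (split_hom _ hf) (split_hom _ hg)).
rewrite legs_smash_comul; try homs.
have [DA1 _] := (sbb_unital sbb).1.
rewrite DA1 tsum_tens; first by rewrite /= (alg_hom1 hf) mul1r.
apply: (legs_bilinear (g := fun a2 => \tsum_(b1, b2 <- DeltaB b)
  legs (f \o inr_t) (g \o inl_t) (tau (a2 ⊗ b1)) * (g \o inr_t) b2)).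
  by homs.
apply: linear_tsum => b1 b2 c x y.
by rewrite linearDl linearZl_LR linearP legs_linear ?mulrDl ?scalerAl; try homs.
Qed.

Lemma quasitriangular_alpha
    (W : B ⊗ B) (X : A ⊗ B) (Y : B ⊗ A) (Z : A ⊗ A) :
  normalized_components epsA epsB W X Y Z ->
  component_identities DeltaA DeltaB epsB tau W X Y Z ->
  smash_quasitriangular DeltaA epsA DeltaB epsB sigma tau (alpha tau W X Y Z).
Proof.
move=> nrm /(component_identitiesP _ _ _ _ _ _ _ tau_alg_hom).
case=> -[c1 c7] [c2 c5] [c3 c6] [c8 c9 c12 c13] [c14 c16 c17 c19] [c10 c11].
move=> [c15 c18].
have Dhom := smash_comul_hom; have thom := tau_alg_hom.
rewrite /smash_quasitriangular smash_mulE alphaE //.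
apply/quasitriangularP; split.
- apply: assembled_counits nrm => //; first exact: smash_counit_mult.
  exact: smash_counit_tens.
- exact: (assembled_splits_left Dhom thom smash_comul_inl smash_comul_inr).
- exact: (assembled_splits_right Dhom thom smash_comul_inl smash_comul_inr).
- exact (assembled_intertwines_cop Dhom smash_comul_inl smash_comul_inr
    c1 c7 c2 c5 c3 c6).
Qed.

Lemma quasitriangular_components (R : H ⊗ H) :
  smash_quasitriangular DeltaA epsA DeltaB epsB sigma tau R ->
  let W := tensor_map q q R in let X := tensor_map p q R in
  let Y := tensor_map q p R in let Z := tensor_map p p R in
  [/\ normalized_components epsA epsB W X Y Z,
      component_identities DeltaA DeltaB epsB tau W X Y Z
    & R = alpha tau W X Y Z].
Proof.
rewrite /smash_quasitriangular smash_mulE => qtR.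
have [[QT1l QT1r] QT2 QT3 QT4] := proj1 (quasitriangularP _ _ _) qtR.
have hp := projA_hom; have hq := projB_hom; have ht := tau_alg_hom.
have pq := legs_comul_projAB lDA lDB leA leB coA coB coH lD.
have qp := legs_comul_projBA lDA lDB leA leB coA coB lD.
have pp := legs_comul_projAA lDA lDB leA leB coA coB coH lD.
have qq := legs_comul_projBB lDA lDB leA leB coA coB coH lD.
have [slA slB] := slides_image hp hq pq qp QT4.
have [usA usB] := unslides_image hp hq pq qp QT4.
have p_surj a : exists h, p h = a.
  exists (inl_t a); rewrite /projA legs_tens //; last exact: triv_linear.
  by rewrite mul_trivr eB.2 scale1r.
have q_surj b : exists h, q h = b.
  exists (inr_t b); rewrite /projB legs_tens //; last exact: triv_linear.
  by rewrite mul_triv eA.2 scale1r.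
have epsp (M : algType k) : triv M epsA \o p =1 triv M eps.
  by move=> x; rewrite (comp_projA epsB (triv_linear M leA)) triv_smash_counit.
have epsq (M : algType k) : triv M epsB \o q =1 triv M eps.
  by move=> x; rewrite (comp_projB epsA (triv_linear M leB)) triv_smash_counit.
split.
- have nrm (C D : algType k) (u : H -> C) (v : H -> D)
      (eC : C -> k) (eD : D -> k) :
      alg_hom u -> alg_hom v -> scalar eC -> scalar eD ->
      (forall M : algType k, triv M eC \o u =1 triv M eps) ->
      (forall M : algType k, triv M eD \o v =1 triv M eps) ->
      normalized eC eD (tensor_map u v R).
    move=> hu hv lC lD' eu ev; apply/normalizedE.
    have lC' := triv_linear D lC; have lD'' := triv_linear C lD'.
    rewrite !legs_image //; split.
      by rewrite (eq_legs _ (eu _) (fun _ => erefl)); apply: legs_trivl1 QT1l _.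
    by rewrite (eq_legs _ (fun _ => erefl) (ev _)); apply: legs_trivr1 QT1r _.
  by split; apply: nrm.
- apply/(component_identitiesP _ _ _ _ _ _ _ ht); split.
  + split; first exact (intertwines_cop_image hp p_surj pp QT4).
    exact (intertwines_cop_image hq q_surj qq QT4).
  + by split.
  + by split.
  + split.
    * exact (splits_left_image hp hp lDA pp QT2).
    * exact (splits_left_image hp hq lDA pp QT2).
    * exact (splits_left_image hq hp lDB qq QT2).
    * exact (splits_left_image hq hq lDB qq QT2).
  + split.
    * exact (splits_right_image hp hp lDA pp QT3).
    * exact (splits_right_image hp hq lDB qq QT3).
    * exact (splits_right_image hq hp lDA pp QT3).
    * exact (splits_right_image hq hq lDB qq QT3).
  + split; first exact (twists_left_image ht hp hq pq qp hp QT2).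
    exact (twists_left_image ht hp hq pq qp hq QT2).
  + split; first exact (twists_right_image ht hp hq pq qp hp QT3).
    exact (twists_right_image ht hp hq pq qp hq QT3).
- rewrite alphaE // -[LHS]legs_inlr.
  rewrite (four_legs_image (p := p) (q := q) hp hq pq) //; homs.
Qed.

End Biproduct.

Theorem corollary4p3 (k : fieldType) (A B : algType k)
    (DeltaA : A -> A ⊗ A) (epsA : A -> k)
    (DeltaB : B -> B ⊗ B) (epsB : B -> k)
    (sigma : {linear (B ⊗ A)%type -> (A ⊗ B)%type})
    (tau : {linear (A ⊗ B)%type -> (B ⊗ A)%type})
    (sbb : smash_biproduct_bialgebra DeltaA epsA DeltaB epsB sigma tau)
    (sigma_left : left_conormal epsB sigma)
    (sigma_right : right_conormal epsA sigma) :
  let qt := smash_quasitriangular DeltaA epsA DeltaB epsB sigma tau in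
  let components W X Y Z :=
    normalized_components epsA epsB W X Y Z /\
    component_identities DeltaA DeltaB epsB tau W X Y Z in
  [/\ (exists R, qt R) <-> (exists W X Y Z, components W X Y Z),
      (forall W X Y Z, components W X Y Z -> qt (alpha tau W X Y Z))
    & (forall R, qt R ->
         exists W X Y Z, components W X Y Z /\ R = alpha tau W X Y Z)].
Proof.
move=> qt components.
have qt_alpha W X Y Z : components W X Y Z -> qt (alpha tau W X Y Z).
  by case=> nrm ids; apply: quasitriangular_alpha.
have qt_components R : qt R ->
    exists W X Y Z, components W X Y Z /\ R = alpha tau W X Y Z.
  case/(quasitriangular_components sbb sigma_left sigma_right) => nrm ids RE.
  by do 4!eexists; split; [split|]; [exact: nrm|exact: ids|exact: RE].
split=> //; split.
  case=> R /qt_components[W [X [Y [Z [WXYZ _]]]]].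
  by exists W, X, Y, Z.
case=> [W [X [Y [Z WXYZ]]]].
by exists (alpha tau W X Y Z); apply: qt_alpha.
Qed.
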